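(* Let $H$ be a finite simple connected balanced graph with $|V(H)|\ge2$, and let $G_n\sim G(n,p)$ be the Erdős–Rényi random graph with $p=p(n)\in(0,1)$. Let $c_n$ be positive integers with $c_n\to\infty$, and color the vertices of $G_n$ uniformly with $c_n$ colors, independently of the graph. Assume that for some $\lambda>0$ $$\mathbb{E}\,T(H,G_n)=\frac{|V(H)|!\binom{n}{|V(H)|}p^{|E(H)|}}{|Aut(H)|\,c_n^{|V(H)|-1}}\longrightarrow\lambda\qquad (n\to\infty).$$ Then: (a) If $n^{-|V(H)|/|E(H)|}\ll p(n)\ll 1$, then $T(H,G_n)$ converges in distribution to $\mathrm{Pois}(\lambda)$. (b) If $p(n)=p\in(0,1)$ is fixed, then $T(H,G_n)$ converges in distribution to $$\sum_{F\supseteq H:\ |V(F)|=|V(H)|}N(H,F)\,X_F,$$ where $X_F\sim\mathrm{Pois}\!\left(\lambda\cdot\frac{|Aut(H)|}{|Aut(F)|}\,p^{|E(F)|-|E(H)|}(1-p)^{\binom{|V(H)|}{2}-|E(F)|}\right)$ and the collection $\{X_F: F\supseteq H,\ |V(F)|=|V(H)|\}$ is independent.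
   Context: For a finite connected graph $H$, $m(H)=\max_{H_1\subseteq H}\frac{|E(H_1)|}{|V(H_1)|}$, the maximum over all non-empty subgraphs $H_1$ of $H$; $H$ is balanced if $m(H)=\frac{|E(H)|}{|V(H)|}$. Coloring: given $G_n$, the vertices receive independent colors $X_v$, each uniform on $\{1,\dots,c_n\}$. $T(H,G_n)$ is the number of monochromatic copies of $H$ in $G_n$: with $V(H)=\{1,\dots,|V(H)|\}$ and $(a_{ij}(G_n))$ the adjacency matrix, $$T(H,G_n)=\frac{1}{|Aut(H)|}\sum_{\boldsymbol s}\prod_{(a,b)\in E(H)}a_{s_as_b}(G_n)\,\mathbf 1\{X_{s_1}=\cdots=X_{s_{|V(H)|}}\},$$ the sum over all tuples of distinct vertices of $G_n$. $\mathbb{E}$ is over both the graph and the coloring. The sum over $F\supseteq H$ with $|V(F)|=|V(H)|$ is over isomorphism classes (unlabelled graphs) $F$ on $|V(H)|$ vertices containing a copy of $H$ as a subgraph ($F=H$ included). $N(H,F)$ is the number of copies of $H$ in $F$ (subgraphs of $F$ isomorphic to $H$, not necessarily induced). $Aut(\cdot)$ is the automorphism group. $a_n\ll b_n$ means $a_n/b_n\to0$. *)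

(* Defs.v *)
From HB Require Import structures.
From mathcomp Require Import all_boot all_order all_fingroup all_algebra.
From mathcomp Require Import all_classical all_reals all_analysis.

Set Implicit Arguments.
Unset Strict Implicit.
Unset Printing Implicit Defensive.

Import Order.TTheory GRing.Theory Num.Theory.
Import numFieldNormedType.Exports.

Local Open Scope ring_scope.

(* A simple graph on the vertex set [V] is given by its set of edges, which   *)
(* are two-element sets of vertices.                                          *)
Record sgraph (V : finType) := SGraph {
  edges : {set {set V}};
  edgesP : [forall e in edges, #|e| == 2] }.

HB.instance Definition _ (V : finType) := [isSub for @edges V].
HB.instance Definition _ (V : finType) := [Finite of sgraph V by <:].

Definition adj (V : finType) (G : sgraph V) : rel V :=
  fun x y => [set x; y] \in edges G.

Definition connected_graph (V : finType) (G : sgraph V) : Prop :=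
  forall x y : V, connect (adj G) x y.

(* A subgraph is a pair (vertex set, edge set).                               *)
Definition subgraph (V : finType) (G : sgraph V)
    (S : {set V} * {set {set V}}) : bool :=
  (S.2 \subset edges G) && [forall e in S.2, e \subset S.1].

(* The neutral element 0 of the iterated maximum plays no role when [V] is    *)
(* nonempty, since all the ratios are nonnegative.                            *)
Definition max_density (V : finType) (G : sgraph V) : rat :=
  \big[Num.max/0]_(S : {set V} * {set {set V}} |
      subgraph G S && (S.1 != finset.set0)) (#|S.2|%:R / #|S.1|%:R).

Definition balanced (V : finType) (G : sgraph V) : Prop :=
  max_density G = #|edges G|%:R / #|V|%:R.

Definition isos (V : finType) (F F' : sgraph V) : {set {perm V}} :=
  finset (fun s : {perm V} =>
    (fun e : {set V} => s @: e) @: edges F == edges F').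

Definition isomorphic (V : finType) : rel (sgraph V) :=
  fun F F' => isos F F' != finset.set0.

Definition aut (V : finType) (G : sgraph V) : {set {perm V}} := isos G G.

Definition copies (V W : finType) (H : sgraph V) (F : sgraph W) :
    {set {set W} * {set {set W}}} :=
  finset (fun S : {set W} * {set {set W}} => subgraph F S &&
    [exists f : {ffun V -> W}, injectiveb f &&
      (S == (f @: [set: V], (fun e : {set V} => f @: e) @: edges H))]).

(* N(H, F)                                                                    *)
Definition ncopies (V W : finType) (H : sgraph V) (F : sgraph W) : nat :=
  #|copies H F|.

(* The unlabelled graphs on #|V| vertices containing a copy of [H], each      *)
(* represented by one of its labellings.                                      *)
Definition supergraphs (V : finType) (H : sgraph V) : {set sgraph V} :=
  let D := finset (fun F : sgraph V => (0 < ncopies H F)%N) in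
  transversal (equivalence_partition (@isomorphic V) D) D.

Section Monochromatic.
Variables (R : realType) (V : finType) (H : sgraph V) (n c : nat).

(* T(H, G) for the coloring [X]; the tuples of distinct vertices are the      *)
(* injective maps from the vertices of [H], and for an edge e = {a, b} of [H] *)
(* the image s @: e is the pair {s a, s b}.                                   *)
Definition mono_copies (G : sgraph 'I_n) (X : {ffun 'I_n -> 'I_c}) : R :=
  #|aut H|%:R^-1 * \sum_(s : {ffun V -> 'I_n} | injectiveb s)
    (\prod_(e in edges H) ((s @: (e : {set V})) \in edges G)%:R)
    * [forall a, forall b, X (s a) == X (s b)]%:R.

End Monochromatic.

Local Open Scope classical_set_scope.

(* [G] is an Erdos-Renyi graph G(n, p), i.e. the pairs of vertices are edges  *)
(* independently with probability p; [X] is a uniform coloring with c colors, *)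
(* i.e. the colors are independent and uniform; [G] and [X] are independent.  *)
Record colored_gnp d (Omega : measurableType d) (R : realType)
    (P : probability Omega R) (n c : nat) (p : R)
    (G : Omega -> sgraph 'I_n) (X : Omega -> {ffun 'I_n -> 'I_c}) : Prop := {
  graph_measurable : forall g, measurable [set w | G w = g];
  coloring_measurable : forall x, measurable [set w | X w = x];
  graph_law : forall g, P [set w | G w = g] =
    (\prod_(e : {set 'I_n} | #|e| == 2)
       (if e \in edges g then p else 1 - p))%:E;
  coloring_law : forall x, P [set w | X w = x] =
    (\prod_(v < n) c%:R^-1)%:E;
  graph_coloring_indep : forall g x,
    P [set w | G w = g /\ X w = x] =
      (P [set w | G w = g] * P [set w | X w = x])%E }.

(* Convergence in distribution of real random variables on possibly different *)
(* probability spaces: the distribution functions converge at every           *)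
(* continuity point of the limiting distribution function.                    *)
Definition cvg_in_distribution (R : realType) (d : nat -> measure_display)
    (Omega : forall n, measurableType (d n))
    (P : forall n, probability (Omega n) R) (Y : forall n, Omega n -> R)
    d' (Omega' : measurableType d') (Q : probability Omega' R)
    (Z : Omega' -> R) : Prop :=
  forall t : R,
    {for t, continuous (fun s : R => Q [set w | Z w <= s])} ->
    P n [set w | Y n w <= t] @[n --> \oo] --> Q [set w | Z w <= t].

(* Mutual independence of the family (X i) for i in J. Every subset of nat is *)
(* measurable, hence the arbitrary [B].                                       *)
Definition mutually_independent d (Omega : measurableType d) (R : realType)
    (Q : probability Omega R) (I : finType) (J : {set I})
    (X : I -> {RV Q >-> nat}) : Prop :=
  forall (K : {set I}) (B : I -> set nat), K \subset J ->
    Q [set w | forall i, i \in K -> B i (X i w)] =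
      (\prod_(i in K) Q [set w | B i (X i w)])%E.

(* The second argument of [poisson_prob] is not used by its definition.       *)
Definition pois (R : realType) (rate : R) : probability nat R :=
  poisson_prob rate 0%N.

Definition much_less (R : realType) (a b : nat -> R) : Prop :=
  a n / b n @[n --> \oo] --> (0 : R).

Definition limit_rate (R : realType) (V : finType) (H F : sgraph V)
    (lambda p : R) : R :=
  lambda * (#|aut H|%:R / #|aut F|%:R) * p ^+ (#|edges F| - #|edges H|)
    * (1 - p) ^+ ('C(#|V|, 2) - #|edges F|).

(* Main.v *)
Require Import Defs.
From mathcomp Require Import all_boot all_order all_fingroup all_algebra.
From mathcomp Require Import all_classical all_reals all_analysis.
From mathcomp Require Import ring lra zify measurable_realfun.
Import Order.TTheory GRing.Theory Num.Theory.
Import numFieldNormedType.Exports.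
Set Implicit Arguments.
Unset Strict Implicit.
Unset Printing Implicit Defensive.
Local Open Scope ring_scope.

(** Write k and e for the numbers of vertices and edges of H.  Group the
    monochromatic copies of H by their vertex set: T is the sum over the sets S
    of k vertices of the clump Y_S, which is the number of copies of H on S if
    S is monochromatic and 0 otherwise.  Clumps are rare and nearly
    independent, so the number of clumps of size j should be nearly Poisson
    with parameter L_j = sum_S P(Y_S = j), independently in j, and T nearly
    compound Poisson.

    The mass function of a sum W of j X_j, with independent Poisson X_j of
    parameter L_j, is the only one that satisfies
      m P(W = m) = sum_j j L_j P(W = m - j)   for all m,
    and the whole argument is about this recursion.  Since
    m P(T = m) = sum_S E[Y_S; T = m], and since on the event Y_S = j the
    condition T = m can be traded for one on the clumps disjoint from S, which
    are independent of Y_S, the variable T satisfies the recursion up to an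
    error controlled by pairs of overlapping clumps ([approx_recursion]).  An
    approximate recursion with converging coefficients, together with bounded
    means, forces the mass functions to converge ([pmf_cvg]), hence the
    distribution functions ([pmf_cvg_in_distribution]).

    The error has two parts.  The products of expectations of overlapping
    clumps add up to O((E T)^2 / n).  The joint probabilities of overlapping
    clumps are where balancedness enters ([balanced_subgraph]): two copies that
    share i vertices share at most e i / k edges, so all pairs of this kind
    contribute at most a constant times
      n^(2k-i) p^(2e - e i / k) c^-(2k-i-1).
    The k-th power of this term is at most mu^(2k-i) c^-(k-i) with
    mu = n^k p^e / c^(k-1), a quantity comparable to E T and hence bounded; as
    0 < i < k and c tends to infinity, the term vanishes ([scale_pow_le]).

    For the coefficients, the probability that a given set of k vertices spans
    a given labelled graph F is p^e(F) (1-p)^(C(k,2)-e(F)), so ([clump_coeff])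
      L_j = E T * |Aut H| / k! * sum_F p^(e(F)-e(H)) (1-p)^(C(k,2)-e(F))
    over the labelled graphs F on the vertices of H with N(H,F) = j.  This is a
    polynomial in p, so both regimes are the same statement for p tending to
    some q in [0,1).  For q = 0 only the graphs isomorphic to H survive, and
    the limit is Poisson ([limit_rate_sparse]).  For q > 0 the isomorphism
    class of F has k! / |Aut F| members, and collecting them gives the rates of
    the independent Poisson variables ([limit_rate_sum]). *)

(** * A finite expectation and the recursion for sums of local counts *)

Section FiniteExpectation.
Variables (R : realFieldType) (Om : finType) (w : Om -> R).

(** The weights need not be normalized: the same sum is used for the graph
    alone, for the colouring alone, and for the pair. *)
Definition fexp (f : Om -> R) : R := \sum_o w o * f o.

Lemma fexp_eq f g : f =1 g -> fexp f = fexp g.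
Proof. by move=> fg; apply: eq_bigr => o _; rewrite fg. Qed.

Lemma fexpB f g : fexp (fun o => f o - g o) = fexp f - fexp g.
Proof. by rewrite /fexp -sumrB; apply: eq_bigr => o _; rewrite mulrBr. Qed.

Lemma fexpZ a f : fexp (fun o => a * f o) = a * fexp f.
Proof. by rewrite /fexp mulr_sumr; apply: eq_bigr => o _; rewrite mulrCA. Qed.

Lemma fexp_sum (I : finType) (A : pred I) (f : I -> Om -> R) :
  fexp (fun o => \sum_(i | A i) f i o) = \sum_(i | A i) fexp (f i).
Proof.
by rewrite /fexp exchange_big; apply: eq_bigr => o _; rewrite mulr_sumr.
Qed.

Hypothesis w_ge0 : forall o, 0 <= w o.

Lemma fexp_le f g : (forall o, f o <= g o) -> fexp f <= fexp g.
Proof. by move=> fg; apply: ler_sum => o _; rewrite ler_wpM2l. Qed.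

Lemma fexp_ge0 f : (forall o, 0 <= f o) -> 0 <= fexp f.
Proof. by move=> f0; apply: sumr_ge0 => o _; rewrite mulr_ge0. Qed.

Lemma fexp_abs f : `|fexp f| <= fexp (fun o => `|f o|).
Proof.
apply: le_trans (ler_norm_sum _ _ _) _; apply: ler_sum => o _.
by rewrite normrM (ger0_norm (w_ge0 o)).
Qed.

Section Recursion.
Variables (I : finType) (Y : I -> Om -> nat) (near : rel I) (K : nat).
Hypothesis near_refl : reflexive near.
Hypothesis Y_le : forall i o, (Y i o <= K)%N.

Let total o := (\sum_i Y i o)%N.
Let far i o := (\sum_(i' | ~~ near i i') Y i' o)%N.

Hypothesis far_indep : forall i (f g : nat -> R),
  fexp (fun o => f (Y i o) * g (far i o)) =
  fexp (fun o => f (Y i o)) * fexp (fun o => g (far i o)).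

Let coeff j := j%:R * \sum_i fexp (fun o => (Y i o == j)%:R).

Let total_split i o :
  total o = (Y i o + \sum_(i' | near i i' && (i' != i)) Y i' o + far i o)%N.
Proof.
rewrite /total /far (bigID (near i)) /=; congr addn.
by rewrite (bigD1 i) //=.
Qed.

Let total_eq_far i o :
  (forall i', near i i' -> i' != i -> Y i' o = 0%N) ->
  total o = (Y i o + far i o)%N.
Proof.
move=> Y0; rewrite (total_split i) big1 ?addn0 // => i' /andP[]; exact: Y0.
Qed.

Lemma le_sum_indic (A : pred I) o i : A i -> Y i o != 0%N ->
  1 <= \sum_(i' | A i') (0 < Y i' o)%N%:R :> R.
Proof.
move=> Ai Yi; rewrite (bigD1 i) //= lt0n Yi /=.
by rewrite lerDl sumr_ge0.
Qed.

(** Two replacements.  While Y_i is not zero, [total] and [Y i + far i] differ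
    only if another neighbour is nonzero; independence then splits the
    expectation, and the distribution of [far i] is turned back into that of
    [total], which costs the expectations of the neighbours of i. *)
Lemma recursion_step i m :
  `|fexp (fun o => (Y i o)%:R * (total o == m)%:R)
   - \sum_(j < K.+1) j%:R * fexp (fun o => (Y i o == j)%:R)
                         * fexp (fun o => (j + total o == m)%N%:R)| <=
  K%:R * \sum_(i' | near i i' && (i' != i))
            fexp (fun o => (0 < Y i o)%N%:R * (0 < Y i' o)%N%:R)
  + fexp (fun o => (Y i o)%:R)
      * \sum_(i' | near i i') fexp (fun o => (Y i' o)%:R).
Proof.
pose mid := fexp (fun o => (Y i o)%:R * (Y i o + far i o == m)%N%:R).
apply: le_trans (ler_distD mid _ _) _; apply: lerD.
  rewrite -fexpB; apply: le_trans (fexp_abs _) _.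
  rewrite -fexp_sum -fexpZ; apply: fexp_le => o.
  rewrite -mulr_sumr.
  have [Yi0|Yi0] := posnP (Y i o);
    first by rewrite Yi0 !mul0r subrr normr0 mulr0.
  rewrite mul1r -mulrBr normrM normr_nat.
  case: (pickP [pred i' | near i i' && (i' != i) && (Y i' o != 0%N)]) =>
      [i' /andP[Ai' Yi'] | Y0].
    apply: ler_pM => //; first by rewrite ler_nat.
    apply: le_trans (le_sum_indic (A := fun i' =>
      near i i' && (i' != i)) Ai' Yi').
    by case: eqP; case: eqP => _ _;
      rewrite ?subrr ?normr0 ?subr0 ?sub0r ?normrN ?normr1.
  rewrite (@total_eq_far i); last first.
    by move=> i' n1 n2; have := Y0 i'; rewrite /= n1 n2 /=; case: eqP.
  by rewrite subrr normr0 mulr0 mulr_ge0 // sumr_ge0.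
have midE : mid = \sum_(j < K.+1) j%:R * fexp (fun o => (Y i o == j)%:R)
                         * fexp (fun o => (j + far i o == m)%N%:R).
  rewrite /mid; under [RHS]eq_bigr => j _.
    rewrite -mulrA -(@far_indep i (fun a => (a == j)%:R) (fun a =>
      (j + a == m)%N%:R)) -fexpZ.
    over.
  rewrite -fexp_sum; apply: fexp_eq => o.
  have Yi : (Y i o < K.+1)%N by rewrite ltnS.
  rewrite (bigD1 (Ordinal Yi)) //= eqxx mul1r big1 ?addr0 // => j.
  rewrite -val_eqE /= eq_sym => /negbTE ->; by rewrite mul0r mulr0.
rewrite midE -sumrB.
apply: le_trans (ler_norm_sum _ _ _) _.
have -> : fexp (fun o => (Y i o)%:R) =
    \sum_(j < K.+1) j%:R * fexp (fun o => (Y i o == j)%:R).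
  under [RHS]eq_bigr => j _ do rewrite -fexpZ.
  rewrite -fexp_sum; apply: fexp_eq => o.
  have Yi : (Y i o < K.+1)%N by rewrite ltnS.
  rewrite (bigD1 (Ordinal Yi)) //= eqxx mulr1 big1 ?addr0 // => j.
  rewrite -val_eqE /= eq_sym => /negbTE ->; by rewrite mulr0.
rewrite mulr_suml; apply: ler_sum => j _.
rewrite -mulrBr normrM ger0_norm; last first.
  by rewrite mulr_ge0 // fexp_ge0.
apply: ler_wpM2l; first by rewrite mulr_ge0 // fexp_ge0.
rewrite -fexpB; apply: le_trans (fexp_abs _) _.
rewrite -fexp_sum; apply: fexp_le => o.
apply: (@le_trans _ _ (\sum_(i' | near i i') (0 < Y i' o)%N%:R)); last first.
  by apply: ler_sum => i' _; rewrite ler_nat; case: (Y i' o).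
case: (pickP [pred i' | near i i' && (Y i' o != 0%N)]) =>
      [i' /andP[Ai' Yi'] | Y0].
  apply: le_trans (le_sum_indic (A := near i) Ai' Yi').
  by case: eqP; case: eqP => _ _;
    rewrite ?subrr ?normr0 ?subr0 ?sub0r ?normrN ?normr1.
have {}Y0 i' : near i i' -> Y i' o = 0%N.
  by move=> n1; have := Y0 i'; rewrite /= n1 /=; case: eqP.
rewrite (@total_eq_far i) => [|i' n1 _]; last exact: Y0.
by rewrite (Y0 i) // add0n subrr normr0 sumr_ge0.
Qed.

(** The recursion m P(T = m) = sum_j j L_j P(T = m - j) of a compound Poisson
    law, up to an error that only involves pairs of neighbours.  Writing
    [j + total = m] in place of [total = m - j] avoids truncated
    subtraction. *)
Lemma approx_recursion m :
  `|m%:R * fexp (fun o => (total o == m)%:R)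
    - \sum_(j < K.+1) coeff j * fexp (fun o => (j + total o == m)%N%:R)| <=
  K%:R * \sum_i \sum_(i' | near i i' && (i' != i))
            fexp (fun o => (0 < Y i o)%N%:R * (0 < Y i' o)%N%:R)
  + \sum_i \sum_(i' | near i i')
      fexp (fun o => (Y i o)%:R) * fexp (fun o => (Y i' o)%:R).
Proof.
have -> : m%:R * fexp (fun o => (total o == m)%:R) =
    \sum_i fexp (fun o => (Y i o)%:R * (total o == m)%:R).
  rewrite -fexp_sum -fexpZ; apply: fexp_eq => o.
  rewrite -mulr_suml -natr_sum -/(total o).
  by case: eqP => [->|]; rewrite ?mulr0.
have -> : \sum_(j < K.+1) coeff j * fexp (fun o => (j + total o == m)%N%:R) =
    \sum_i \sum_(j < K.+1) j%:R * fexp (fun o => (Y i o == j)%:R)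
                         * fexp (fun o => (j + total o == m)%N%:R).
  rewrite exchange_big; apply: eq_bigr => j _.
  by rewrite /coeff -!mulr_suml -mulr_sumr.
rewrite -sumrB mulr_sumr -big_split /=.
apply: le_trans (ler_norm_sum _ _ _) _; apply: ler_sum => i _.
by rewrite -mulr_sumr; exact: recursion_step.
Qed.

End Recursion.
End FiniteExpectation.

Local Open Scope classical_set_scope.

(** * Mass functions determined by a recursion *)

Section Limit.
Variables (R : realType) (K : nat) (u : nat -> nat -> R) (q : nat -> R)
  (a : nat -> nat -> R) (b : nat -> R) (mean : nat -> R) (lambda : R).
Hypothesis u_ge0 : forall n m, 0 <= u n m.
Hypothesis u_sum : forall n M, \sum_(m < M) u n m <= 1.
Hypothesis u_tail : forall n M, M%:R * (1 - \sum_(m < M) u n m) <= mean n.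
Hypothesis mean_cvg : mean n @[n --> \oo] --> lambda.
Hypothesis q_ge0 : forall m, 0 <= q m.
Hypothesis q_sum : \sum_(m < M) q m @[M --> \oo] --> (1 : R).
Hypothesis a0 : forall n, a n 0 = 0.
Hypothesis a_cvg : forall j, (j <= K)%N -> a n j @[n --> \oo] --> b j.
Hypothesis u_rec : forall m,
  m%:R * u n m - \sum_(j < K.+1 | (j <= m)%N) a n j * u n (m - j)
    @[n --> \oo] --> (0 : R).
Hypothesis q_rec : forall m,
  m%:R * q m = \sum_(j < K.+1 | (j <= m)%N) b j * q (m - j).

Let u_le1 n m : u n m <= 1.
Proof.
apply: le_trans (u_sum n m.+1); rewrite big_ord_recr /= lerDr.
by rewrite sumr_ge0.
Qed.

Let b0 : b 0%N = 0.
Proof.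
have /(cvg_lim (@Rhausdorff R)) <- := a_cvg (leq0n K).
by apply/(cvg_lim (@Rhausdorff R)); under eq_fun do rewrite a0; exact: cvg_cst.
Qed.

Lemma cvg0Z (x : R) (f : nat -> R) : f n @[n --> \oo] --> (0 : R) ->
  x * f n @[n --> \oo] --> (0 : R).
Proof. by move=> f0; rewrite -[X in _ --> X](mulr0 x); apply: cvgM => //;
  exact: cvg_cst. Qed.

Lemma cvg0D (f g : nat -> R) : f n @[n --> \oo] --> (0 : R) ->
  g n @[n --> \oo] --> (0 : R) -> f n + g n @[n --> \oo] --> (0 : R).
Proof. by move=> f0 g0; rewrite -[X in _ --> X](addr0 0); exact: cvgD. Qed.

Lemma cvg0_sum (I : Type) (r : seq I) (A : pred I) (f : I -> nat -> R) :
  (forall i, A i -> f i n @[n --> \oo] --> (0 : R)) ->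
  \sum_(i <- r | A i) f i n @[n --> \oo] --> (0 : R).
Proof.
move=> f0; rewrite -[X in _ --> X](_ : \sum_(i <- r | A i) (0 : R) = 0);
  last by rewrite big1.
by apply: cvg_big => //; exact: add_continuous.
Qed.

Lemma cvg_bounded_mul (f g : nat -> R) : f n @[n --> \oo] --> (0 : R) ->
  (forall n, `|g n| <= 1) -> f n * g n @[n --> \oo] --> (0 : R).
Proof.
move=> f0 g1; apply/norm_cvg0P.
apply: (@squeeze_cvgr _ _ _ _ (fun=> 0) (fun n => `|f n|)).
- by near=> n; rewrite normr_ge0 normrM ler_piMr.
- exact: cvg_cst.
- by apply/norm_cvg0P.
Unshelve. all: by end_near. Qed.

(** Both u n and q are determined by their value at 0 through the same
    recursion (up to o(1)), so they are asymptotically proportional; the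
    induction is on m. *)
Lemma cross_cvg m : q 0 * u n m - q m * u n 0 @[n --> \oo] --> (0 : R).
Proof.
elim/ltn_ind: m => -[|m] IH.
  by under eq_fun do rewrite subrr; exact: cvg_cst.
have m0 : m.+1%:R != 0 :> R by rewrite pnatr_eq0.
pose rest n := \sum_(j < K.+1 | (j <= m.+1)%N)
   (b j * (q 0 * u n (m.+1 - j) - q (m.+1 - j) * u n 0)
    + (a n j - b j) * u n (m.+1 - j) * q 0).
have -> : (fun n => q 0 * u n m.+1 - q m.+1 * u n 0) = (fun n =>
   (m.+1%:R)^-1 * (q 0 * (m.+1%:R * u n m.+1 -
      \sum_(j < K.+1 | (j <= m.+1)%N) a n j * u n (m.+1 - j)) + rest n)).
  apply/funext => n; apply: (mulfI m0); rewrite mulVKf //.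
  rewrite mulrBr (mulrA _ (q m.+1)) q_rec /rest mulrBr -addrA mulrCA;
    congr (_ + _).
  rewrite mulr_sumr mulr_suml -!sumrN -big_split /=.
  by apply: eq_bigr => j _; ring.
apply: cvg0Z; apply: cvg0D; first by apply: cvg0Z; exact: u_rec.
apply: cvg0_sum => j jm.
have [->|j0] := posnP j.
  under eq_fun do rewrite b0 a0 subrr !mul0r addr0.
  exact: cvg_cst.
apply: cvg0D; first by apply: cvg0Z; apply: IH; rewrite ltn_subrL j0.
under eq_fun do rewrite mulrC.
apply: cvg0Z.
apply: cvg_bounded_mul; last by move=> n; rewrite ger0_norm.
rewrite -(subrr (b j)); apply: cvgB; last exact: cvg_cst.
by apply: a_cvg; rewrite -ltnS.
Qed.

Let q_sum_le M : \sum_(m < M) q m <= 1.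
Proof.
have := nondecreasing_cvgn_le _ (cvgP _ q_sum) M.
rewrite (cvg_lim (@Rhausdorff R) q_sum); apply.
apply/nondecreasing_seqP => n; rewrite big_ord_recr /= lerDl; exact: q_ge0.
Qed.

Let q0_le1 : q 0 <= 1.
Proof. by have := q_sum_le 1; rewrite big_ord1. Qed.

(** Were q 0 zero, the recursion would make all of q vanish. *)
Lemma q0_gt0 : 0 < q 0.
Proof.
rewrite lt_def q_ge0 andbT; apply/eqP => q00.
suff q_0 m : q m = 0.
  move/(cvg_lim (@Rhausdorff R)): q_sum.
  under eq_fun do rewrite big1 //.
  rewrite lim_cst; last exact: Rhausdorff.
  by move/eqP; rewrite eq_sym oner_eq0.
elim/ltn_ind: m => -[//|m] IH.
apply/eqP; rewrite -(mulrI_eq0 _ (@mulfI _ m.+1%:R _)) ?pnatr_eq0 // q_rec big1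
  // => j _.
have [->|j0] := posnP j; first by rewrite b0 mul0r.
by rewrite IH ?mulr0 // ltn_subrL j0.
Qed.

(** The constant of proportionality is found by summing over m < M: both
    partial sums are close to 1 for large M, for u by Markov's inequality. *)
Lemma u0_cvg : u n 0 @[n --> \oo] --> q 0.
Proof.
apply/cvgrPdist_le => e e0.
(* M is chosen so that both tails, of q and of u n, are below e / 3. *)
have e3 : 0 < e / 3 by rewrite divr_gt0.
have /cvgrPdist_le/(_ _ e3) Qtail := q_sum.
have Mlarge : \forall M \near \oo, (lambda + 1) / (e / 3) <= M%:R.
  exact: nbhs_infty_ger.
have [M _ /(_ M (leqnn M)) [[/= QM M1] LM]] :=
  filterI (filterI Qtail (nbhs_infty_gt 0%N)) Mlarge.
have cr : q 0 * \sum_(m < M) u n m - u n 0 * \sum_(m < M) q m @[n --> \oo] -->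
  (0 : R).
  have -> : (fun n => q 0 * \sum_(m < M) u n m - u n 0 * \sum_(m < M) q m) =
     (fun n => \sum_(m < M) (q 0 * u n m - q m * u n 0)).
    apply/funext => n; rewrite !mulr_sumr -sumrB.
    by apply: eq_bigr => m _; rewrite (mulrC (u n 0)).
  by apply: cvg0_sum => m _; exact: cross_cvg.
move/cvgrPdist_le/(_ _ e3) : cr => cr.
have mn : \forall n \near \oo, mean n <= lambda + 1.
  move/cvgrPdist_le/(_ _ ltr01): mean_cvg; apply: filterS => n.
  by rewrite ler_norml => /andP[? ?]; lra.
near=> n.
have C : `|0 - (q 0 * \sum_(m < M) u n m - u n 0 * \sum_(m < M) q m)| <= e / 3.
  by near: n.
have N : mean n <= lambda + 1 by near: n.
have M0 : 0 < M%:R :> R by rewrite ltr0n.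
have U1 : 1 - \sum_(m < M) u n m <= e / 3.
  rewrite -(ler_pM2l M0); apply: le_trans (u_tail n M) _.
  by apply: le_trans N _; rewrite -ler_pdivrMr.
have U2 := u_sum n M.
have Q2 := q_sum_le M.
have un1 := u_le1 n 0; have un0 := u_ge0 n 0; have q00 := q_ge0 0;
  have q01 := q0_le1.
move: C QM; set U := \sum_(m < M) u n m in U1 U2 *.
set Q := \sum_(m < M) q m in Q2 *.
rewrite !ler_norml => /andP[C1 C2] /andP[Q3 Q4].
have A1 : q 0 * (1 - U) <= e / 3.
  by apply: le_trans U1; rewrite ler_piMl // subr_ge0.
have A2 : 0 <= q 0 * (1 - U) by rewrite mulr_ge0 // subr_ge0.
have A3 : u n 0 * (1 - Q) <= e / 3.
  by apply: le_trans Q4; rewrite ler_piMl // subr_ge0.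
have A4 : 0 <= u n 0 * (1 - Q) by rewrite mulr_ge0 // subr_ge0.
apply/andP; split; lra.
Unshelve. all: by end_near. Qed.

Lemma pmf_cvg m : u n m @[n --> \oo] --> q m.
Proof.
have q0 := lt0r_neq0 q0_gt0.
have -> : (fun n => u n m) =
   (fun n => (q 0)^-1 * ((q 0 * u n m - q m * u n 0) + q m * u n 0)).
  by apply/funext => n; rewrite subrK mulKf.
rewrite -[X in _ --> X](mulKf q0) (mulrC (q 0) (q m)) -{1}(add0r (q m * q 0)).
apply: cvgM; first exact: cvg_cst.
apply: cvgD; first exact: cross_cvg.
by apply: cvgM; [exact: cvg_cst|exact: u0_cvg].
Qed.
End Limit.

(** * Mass functions and distribution functions *)

Lemma measurable_finite_union d (Om : measurableType d)
    (T : finType) (B : pred T) (A : T -> set Om) :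
  (forall t, measurable (A t)) -> measurable [set w | exists2 t, B t & A t w].
Proof.
move=> mA; have -> : [set w | exists2 t, B t & A t w] =
    \bigcup_(t in [set t | B t]) A t.
  by apply/seteqP; split => w [t Bt At]; exists t.
by apply: fin_bigcup_measurable => //; exact: finite_finset.
Qed.

Lemma prob_finite_union d (Om : measurableType d) (R : realType)
    (P : probability Om R) (T : finType) (B : pred T) (A : T -> set Om) :
  (forall t, measurable (A t)) ->
  (forall w t t', A t w -> A t' w -> t = t') ->
  P [set w | exists2 t, B t & A t w] = (\sum_(t | B t) P (A t))%E.
Proof.
move=> mA dA.
have -> : [set w | exists2 t, B t & A t w] = \bigcup_(t in [set t | B t]) A t.
  by apply/seteqP; split => w [t Bt At]; exists t.
have finB : finite_set [set t | B t] by exact: finite_finset.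
have tA : trivIset [set t | B t] A by move=> t t' _ _ [w [At At']];
  exact: dA At At'.
rewrite measure_fin_bigcup // (fsbigE (enum B)) ?enum_uniq //=.
- rewrite big_enum_cond /=; apply: eq_bigl => t.
  by rewrite mem_setE unfold_in; case: (B t).
- by move=> t /=; rewrite mem_enum.
- by move=> t /= Bt; rewrite mem_enum unfold_in Bt.
Qed.

Section ColoredGraph.
Variables (d : measure_display) (Om : measurableType d) (R : realType)
  (P : probability Om R) (n c : nat) (p : R)
  (G : Om -> sgraph 'I_n) (X : Om -> {ffun 'I_n -> 'I_c}).
Hypothesis GX : colored_gnp P p G X.

Definition outcome_weight (o : sgraph 'I_n * {ffun 'I_n -> 'I_c}) : R :=
  (\prod_(e : {set 'I_n} | #|e| == 2) (if e \in edges o.1 then p else 1 - p))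
  * \prod_(v < n) c%:R^-1.

Let fiber o := [set w | (G w, X w) = o].

Let fiberE o : fiber o = [set w | G w = o.1] `&` [set w | X w = o.2].
Proof.
by case: o => g x; apply/seteqP; split => w; rewrite /fiber /= => -[-> ->].
Qed.

Let measurable_fiber o : measurable (fiber o).
Proof.
rewrite fiberE; apply: measurableI.
  exact: (graph_measurable GX).
exact: (coloring_measurable GX).
Qed.

Let prob_fiber o : P (fiber o) = (outcome_weight o)%:E.
Proof.
by rewrite fiberE (graph_coloring_indep GX) (graph_law GX) (coloring_law GX).
Qed.

Lemma outcome_measurable (B : pred (sgraph 'I_n * {ffun 'I_n -> 'I_c})) :
  measurable [set w | B (G w, X w)].
Proof.
have -> : [set w | B (G w, X w)] = [set w | exists2 o, B o & fiber o w].
  apply/seteqP; split => w /=; first by move=> Bw; exists (G w, X w).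
  by case=> o Bo; rewrite /fiber /= => ->.
exact: measurable_finite_union.
Qed.

(** Only finitely many graphs and colourings exist, so every probability about
    the pair is a finite sum of weights; the abstract probability spaces
    disappear from the argument with this lemma and the next. *)
Lemma outcome_prob (B : pred (sgraph 'I_n * {ffun 'I_n -> 'I_c})) :
  P [set w | B (G w, X w)] = (\sum_(o | B o) outcome_weight o)%:E.
Proof.
have -> : [set w | B (G w, X w)] = [set w | exists2 o, B o & fiber o w].
  apply/seteqP; split => w /=; first by move=> Bw; exists (G w, X w).
  by case=> o Bo; rewrite /fiber /= => ->.
rewrite prob_finite_union //; last by move=> w o o'; rewrite /fiber /= => -> ->.
by rewrite -sumEFin; apply: eq_bigr => o _; exact: prob_fiber.
Qed.

Lemma outcome_expectation (f : sgraph 'I_n * {ffun 'I_n -> 'I_c} -> R) :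
  (forall o, 0 <= f o) ->
  ('E_P[fun w => f (G w, X w)] = (\sum_o outcome_weight o * f o)%:E)%E.
Proof.
move=> f0; rewrite unlock.
have -> : (fun w => (f (G w, X w))%:E) =
    (fun w => \sum_o (f o)%:E * (\1_(fiber o) w)%:E)%E.
  apply/funext => w; rewrite (bigD1 (G w, X w)) //= indicE mem_set // mule1.
  rewrite big1 ?adde0 // => o oGX; rewrite indicE memNset ?mule0 //.
  by rewrite /fiber /= => Go; rewrite Go eqxx in oGX.
rewrite ge0_integral_sum //; last 2 first.
- move=> o; apply: measurable_funeM; apply/measurable_EFinP.
  exact: measurable_indic.
- by move=> o w _; rewrite mule_ge0 // lee_fin.
rewrite -sumEFin; apply: eq_bigr => o _.
rewrite ge0_integralZl_EFin //.
  rewrite integral_indic // setIT EFinM muleC.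
  by congr (_ * _)%E; exact: prob_fiber.
by apply/measurable_EFinP; exact: measurable_indic.
Qed.

End ColoredGraph.

Section NatValued.
Variables (R : realType).

Definition pmf d (Om : measurableType d) (P : probability Om R) (W : Om -> nat)
  (m : nat) : R := fine (P [set w | W w = m]).

Section Pmf.
Variables (d : measure_display) (Om : measurableType d) (P : probability Om R)
  (W : Om -> nat).
Hypothesis mW : forall m, measurable [set w | W w = m].

Lemma pmfE m : P [set w | W w = m] = (pmf P W m)%:E.
Proof. by rewrite /pmf fineK // fin_num_measure. Qed.

Lemma pmf_ge0 m : 0 <= pmf P W m.
Proof. by rewrite -lee_fin -pmfE. Qed.

Lemma prob_pmf M (B : pred 'I_M) :
  P [set w | exists2 m : 'I_M,
    B m & W w = m] = (\sum_(m < M | B m) pmf P W m)%:E.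
Proof.
rewrite (@prob_finite_union _ _ _ P _ B (fun m : 'I_M => [set w | W w = m])) //.
  by rewrite -sumEFin; apply: eq_bigr => m _; rewrite pmfE.
by move=> w m m' /= -> /val_inj.
Qed.

Lemma pmf_sum_cvg : \sum_(m < M) pmf P W m @[M --> \oo] --> (1 : R).
Proof.
pose F M := [set w | exists2 m : 'I_M, xpredT m & W w = m].
have FU : \bigcup_M F M = setT.
  apply/seteqP; split => // w _; exists (W w).+1 => //=.
  by exists (Ordinal (ltnSn (W w))).
have mF M : measurable (F M).
  exact: (@measurable_finite_union _ _ _ _ (fun m : 'I_M => [set w | W w = m])).
have ndF : nondecreasing_seq F.
  move=> M N MN; apply/subsetPset => w [m _ Wm].
  by exists (widen_ord MN m).
have := nondecreasing_cvg_mu (mu := P) mF _ ndF.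
rewrite FU => /(_ measurableT).
rewrite [X in _ --> X -> _](_ : _ = 1%E); last exact: probability_setT.
move/fine_cvg => FP; rewrite (_ : (fun M => _) = (fun M => fine (P (F M))));
  first exact: FP.
by apply/funext => M; rewrite prob_pmf.
Qed.

Lemma nat_cdf (t : R) M : t < M%:R ->
  P [set w | (W w)%:R <= t] = (\sum_(m < M | m%:R <= t) pmf P W m)%:E.
Proof.
move=> tM; rewrite -prob_pmf; congr (P _); apply/seteqP; split => w /=.
  move=> Wt; have WM : (W w < M)%N by rewrite -(ltr_nat R);
    exact: le_lt_trans tM.
  by exists (Ordinal WM).
by case=> m mt ->.
Qed.

End Pmf.

(** For variables with values in nat the convergence of the distribution
    functions holds at every point, not only at continuity points: each of them
    is a finite sum of masses. *)
Lemma pmf_cvg_in_distribution (d : nat -> measure_display)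
    (Omega : forall n, measurableType (d n))
    (P : forall n, probability (Omega n) R) (T : forall n, Omega n -> nat)
    (Y : forall n, Omega n -> R)
    d' (Omega' : measurableType d') (Q : probability Omega' R)
    (W : Omega' -> nat) :
  (forall n w, Y n w = (T n w)%:R) ->
  (forall n m, measurable [set w | T n w = m]) ->
  (forall m, measurable [set w | W w = m]) ->
  (forall m, pmf (P n) (T n) m @[n --> \oo] --> pmf Q W m) ->
  cvg_in_distribution P Y Q (fun w => (W w)%:R).
Proof.
move=> YT mT mW TW t _.
have [M tM] : exists M, t < M%:R by exists (Num.truncn t).+1; exact: truncnS_gt.
rewrite (nat_cdf Q mW tM).
have cdfE n : P n [set w | Y n w <= t] =
    (\sum_(m < M | m%:R <= t) pmf (P n) (T n) m)%:E.
  rewrite -(nat_cdf (P n) (mT n) tM); congr (P n _).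
  by apply/seteqP; split => w; rewrite /= YT.
under eq_fun do rewrite cdfE.
apply: cvg_EFin; first by near=> n.
apply: cvg_big => [|m _]; first exact: add_continuous.
exact: TW.
Unshelve. all: by end_near. Qed.

End NatValued.

(** * Compound Poisson distributions *)

Section Poisson.
Variable R : realType.

Lemma pois_set1 (r : R) a : 0 < r -> pois r [set a] = (poisson_pmf r a)%:E.
Proof.
move=> r0; rewrite /pois /= /poisson_prob r0 esum_set1 // lee_fin.
exact: poisson_pmf_ge0.
Qed.

(** The recursion of a single Poisson law; that of a compound law comes from
    applying it in one coordinate at a time. *)
Lemma poisson_pmf_succ (r : R) a : 0 < r ->
  a.+1%:R * poisson_pmf r a.+1 = r * poisson_pmf r a.
Proof.
move=> r0; rewrite /poisson_pmf r0 factS natrM exprS invfM.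
have a0 : a.+1%:R != 0 :> R by rewrite pnatr_eq0.
move: (_`!%:R^-1) (expR _) (_ ^+ a) => x y z.
by field.
Qed.

Section Compound.
Variables (d : measure_display) (Om : measurableType d) (Q : probability Om R)
  (I : finType) (J : {set I}) (N : I -> nat) (Z : I -> {RV Q >-> nat}) (r :
    I -> R).
Hypothesis N_gt0 : forall i, i \in J -> (0 < N i)%N.
Hypothesis r_gt0 : forall i, i \in J -> 0 < r i.
Hypothesis Z_pois : forall i, i \in J -> distribution Q (Z i) =1 pois (r i).
Hypothesis Z_indep : mutually_independent J Z.

Let W w := (\sum_(i in J) N i * Z i w)%N.

Let measurable_Z i a : measurable [set w | Z i w = a].
Proof.
have -> : [set w | Z i w = a] = Z i @^-1` [set a] by [].
by rewrite -[X in measurable X]setTI; exact: measurable_funP.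
Qed.

(** As the N i are positive, W w = m bounds every coordinate by m: for m <= M
    only finitely many vectors of values matter. *)
Section Box.
Variable M : nat.
Local Notation box := {ffun I -> 'I_M.+1}.

Let supported (z : box) := [forall i, (i \notin J) ==> (z i == 0 :> nat)].

Let level (m : nat) (z : box) := supported z && (\sum_(i in J) N i * z i ==
  m)%N.

Let mass (z : box) := \prod_(i in J) poisson_pmf (r i) (z i).

(** The value 0 off J makes the cells of different vectors disjoint. *)
Let cell (z : box) := [set w | forall i,
  (if i \in J then Z i w else 0%N) = z i].

Let cell_disjoint w z z' : cell z w -> cell z' w -> z = z'.
Proof. by move=> zw zw'; apply/ffunP => i; apply/val_inj;
  rewrite /= -zw -zw'. Qed.

Let measurable_cell z : measurable (cell z).
Proof.
have -> : cell z = \bigcap_(i in [set: I])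
    [set w | (if i \in J then Z i w else 0%N) = z i].
  by apply/seteqP; split => w /= zw i; [move=> _; exact: zw|exact: zw].
apply: fin_bigcap_measurable => [|i _]; first exact: finite_finset.
case: (i \in J); first exact: measurable_Z.
by have [->|zi] := eqVneq (nat_of_ord (z i)) 0%N;
  [rewrite (_ : [set _ | _] = setT) //; apply/seteqP|
   rewrite (_ : [set _ | _] = set0) //; apply/seteqP; split => // w /= z0;
     rewrite -z0 in zi].
Qed.

Let prob_cell z : supported z -> Q (cell z) = (mass z)%:E.
Proof.
move=> /forallP zJ.
have -> : cell z = [set w | forall i,
  i \in J -> [set nat_of_ord (z i)] (Z i w)].
  apply/seteqP; split => w /= zw i; first by move=> iJ; have := zw i;
    rewrite iJ.
  case: ifP => iJ; first exact: zw.
  by have := zJ i; rewrite iJ /= => /eqP ->.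
rewrite (Z_indep (fun i => [set nat_of_ord (z i)])) //.
rewrite -prodEFin; apply: eq_bigr => i iJ.
by rewrite -(pois_set1 _ (r_gt0 iJ)) -(Z_pois iJ).
Qed.

Let W_level m : (m <= M)%N ->
  [set w | W w = m] = [set w | exists2 z, level m z & cell z w].
Proof.
move=> mM; apply/seteqP; split => w /=; last first.
  case=> z /andP[_ /eqP <-] zw; apply: eq_bigr => i iJ.
  by have := zw i; rewrite iJ => ->.
move=> Ww.
have small i : ((if i \in J then Z i w else 0%N) < M.+1)%N.
  case: ifP => // iJ; rewrite ltnS; apply: leq_trans mM;
    rewrite -Ww /W (bigD1 i) //=.
  by apply: leq_trans (leq_addr _ _); rewrite leq_pmull // N_gt0.
exists [ffun i => Ordinal (small i)]; last by move=> i; rewrite ffunE.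
apply/andP; split.
  by apply/forallP => i; apply/implyP => iJ; rewrite ffunE /= (negbTE iJ).
by rewrite -Ww; apply/eqP; apply: eq_bigr => i iJ; rewrite ffunE /= iJ.
Qed.

Lemma compound_measurable m : (m <= M)%N -> measurable [set w | W w = m].
Proof. by move=> mM; rewrite W_level //; exact: measurable_finite_union. Qed.

Lemma compound_pmf m : (m <= M)%N -> pmf Q W m = \sum_(z | level m z) mass z.
Proof.
move=> mM; rewrite /pmf W_level // (prob_finite_union _ _ measurable_cell) //.
rewrite (eq_bigr (fun z => (mass z)%:E)) => [|z /andP[zJ _]];
  last exact: prob_cell.
by rewrite sumEFin.
Qed.

(** Removing one unit from coordinate i maps the vectors of level m with
    z i > 0 onto those of level m - N i, and turns the factor z i of the
    mass into r i. *)
Lemma level_shift i m : i \in J -> (m <= M)%N ->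
  \sum_(z : box | level m z) (z i)%:R * mass z =
  (if (N i <= m)%N then r i * \sum_(z : box | level (m - N i) z) mass z else 0).
Proof.
move=> iJ mM.
have small (z : box) j : level m z -> j \in J -> (N j * z j <= m)%N.
  by case/andP=> _ /eqP <- jJ; rewrite (bigD1 j) //= leq_addr.
rewrite (bigID (fun z : box => (0 < z i)%N)) /= [X in _ + X]big1 ?addr0;
  last first.
  by move=> z /andP[_]; rewrite lt0n negbK => /eqP ->; rewrite mul0r.
case: leqP => Nm; last first.
  rewrite big1 // => z /andP[zm zi]; have := small _ _ zm iJ.
  by rewrite leqNgt (leq_trans Nm) // leq_pmulr.
pose up (z : box) : box := [ffun j => if j == i then inord (z j).+1 else z j].
pose down (z : box) : box := [ffun j => if j == i then inord (z j).-1 else z j].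
have downK (z : box) : (0 < z i)%N -> up (down z) = z.
  move=> zi; apply/ffunP => j; rewrite !ffunE; case: eqP => [->|//].
  have zM := ltn_ord (z i).
  have pM : ((z i).-1 < M.+1)%N by lia.
  by rewrite (inordK pM) prednK // inord_val.
have upK (z : box) : (z i < M)%N -> down (up z) = z.
  move=> zi; apply/ffunP => j; rewrite !ffunE; case: eqP => [->|//].
  have sM : ((z i).+1 < M.+1)%N by [].
  by rewrite (inordK sM) inord_val.
rewrite (reindex_onto up down) => [|z /andP[_]]; last exact: downK.
rewrite mulr_sumr.
have sum_up (z : box) : (z i < M)%N ->
    (\sum_(j in J) N j * up z j = N i + \sum_(j in J) N j * z j)%N.
  move=> zi; rewrite (bigD1 i) //= [in RHS](bigD1 i) //= ffunE eqxx inordK //.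
  rewrite mulnS addnA; congr (_ + _)%N.
  by apply: eq_bigr => j /andP[_ /negbTE ji]; rewrite ffunE ji.
have supp_up (z : box) : supported (up z) = supported z.
  apply: eq_forallb => j; case: (boolP (j \in J)) => //= jJ.
  by rewrite ffunE; have [ji|//] := eqVneq j i; rewrite ji iJ in jJ.
apply: eq_big => [z|z /andP[/andP[_ zi] /eqP zK]].
  have [zi|zi] := ltnP (z i) M.
    rewrite upK // eqxx andbT {2}/up ffunE eqxx inordK // andbT /level supp_up
      sum_up //.
    by congr (_ && _); apply/eqP/eqP; lia.
  have -> : (0 < up z i)%N = false.
    have zM : z i = M :> nat by apply/eqP; rewrite eqn_leq zi -ltnS ltn_ord.
    rewrite ffunE eqxx zM /inord /insubd insubF //= ltnn //.
  rewrite andbF /=; apply/esym/negbTE; apply/andP => -[_ /eqP zm].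
  have : (N i * z i <= m - N i)%N by rewrite -zm (bigD1 i) //= leq_addr.
  have := N_gt0 iJ; have : (z i <= N i * z i)%N by rewrite leq_pmull // N_gt0.
  by lia.
have zM : (z i < M)%N.
  rewrite ltnNge; apply/negP => Mz; move: zi; rewrite ffunE eqxx.
  have -> : z i = M :> nat by apply/eqP; rewrite eqn_leq Mz -ltnS ltn_ord.
  by rewrite /inord /insubd insubF //= ltnn.
rewrite /mass (bigD1 i) //= [in RHS](bigD1 i) //= ffunE eqxx inordK //.
rewrite !mulrA poisson_pmf_succ ?r_gt0 //; congr (_ * _).
by apply: eq_bigr => j /andP[_ /negbTE ji]; rewrite ffunE ji.
Qed.

Lemma compound_level_recursion m : (m <= M)%N ->
  m%:R * pmf Q W m = \sum_(i in J | (N i <= m)%N) (N i)%:R * r i * pmf Q W (m -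
    N i).
Proof.
move=> mM; rewrite compound_pmf // [RHS]big_mkcondr mulr_sumr.
transitivity (\sum_(i in J) (N i)%:R * \sum_(z | level m z) (z i)%:R * mass z).
  under [RHS]eq_bigr do rewrite mulr_sumr.
  rewrite exchange_big; apply: eq_bigr => z /andP[_ /eqP <-] /=.
  by rewrite natr_sum mulr_suml; apply: eq_bigr => i _; rewrite natrM mulrA.
apply: eq_bigr => i iJ; rewrite level_shift //; case: ifP => Nm;
  last by rewrite mulr0.
by rewrite mulrA compound_pmf //; apply: leq_trans mM; exact: leq_subr.
Qed.

End Box.

Lemma measurable_compound m : measurable [set w | W w = m].
Proof. exact: (@compound_measurable m). Qed.

Lemma compound_recursion m :
  m%:R * pmf Q W m = \sum_(i in J | (N i <= m)%N) (N i)%:R * r i * pmf Q W (m -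
    N i).
Proof. exact: (@compound_level_recursion m). Qed.

End Compound.
End Poisson.

Close Scope classical_set_scope.

(** * Copies, embeddings and isomorphism classes *)

From mathcomp Require Import finset.

Lemma injection_surj (V : finType) (r : V -> V) : injective r ->
  r @: [set: V] = [set: V].
Proof. by move=> ri; apply/eqP;
  rewrite eqEcard finset.subsetT /= card_imset. Qed.

Section Embeddings.
Variables (V W : finType).

Definition im_edges (s : V -> W) (E : {set {set V}}) : {set {set W}} :=
  [set s @: (e : {set V}) | e in E].

Definition embedding (H : sgraph V) (s : V -> W) :
    {set W} * {set {set W}} := (s @: [set: V], im_edges s (edges H)).

Lemma edge_card (G : sgraph V) e : e \in edges G -> #|e| = 2.
Proof. by move=> eG; have /forall_inP/(_ e eG)/eqP := edgesP G. Qed.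

Lemma card_im_edges (s : V -> W) E : injective s -> #|im_edges s E| = #|E|.
Proof. by move=> s_inj; rewrite card_imset //; exact: imset_inj. Qed.

Lemma copiesP (H : sgraph V) (g : sgraph W) C :
  reflect (exists2 s : {ffun V -> W}, injective s &
             C = embedding H s /\ im_edges s (edges H) \subset edges g)
          (C \in copies H g).
Proof.
rewrite inE; apply: (iffP andP) =>
  [[/andP[Cg _] /existsP[s /andP[/injectiveP si /eqP CE]]]|].
  by exists s => //; split; rewrite // CE in Cg *.
case=> s si [-> sg]; split.
  rewrite /subgraph sg /=; apply/forall_inP => _ /imsetP[e _ ->].
  by apply: imsetS; exact: finset.subsetT.
by apply/existsP; exists s; rewrite eqxx andbT; exact/injectiveP.
Qed.

Lemma factor_injection (s t : {ffun V -> W}) : injective s -> injective t ->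
  s @: [set: V] \subset t @: [set: V] ->
  exists r : {perm V}, forall v, s v = t (r v).
Proof.
move=> si ti st.
have ex v : exists u, s v == t u.
  have /(fintype.subsetP st)/imsetP[u _ ->] : s v \in s @: [set: V] by apply:
    imset_f; rewrite inE.
  by exists u.
pose r v := xchoose (ex v).
have rE v : s v = t (r v) by apply/eqP; exact: (xchooseP (ex v)).
have ri : injective r by move=> u v ruv; apply: si; rewrite !rE ruv.
by exists (perm ri) => v; rewrite permE.
Qed.

(** Two injections with the same image copy differ by an automorphism of H, so
    a sum over injections is |Aut H| times a sum over copies. *)
Lemma embedding_fiber (H : sgraph V) (t : {ffun V -> W}) : injective t ->
  #|[set s : {ffun V -> W} | injectiveb s && (embedding H s == embedding H t)]|
  = #|Defs.aut H|.
Proof.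
move=> ti.
pose f (r : {perm V}) := [ffun v => t (r v)].
have fi : injective f.
  by move=> r r' /ffunP E; apply/permP => v; apply: ti; have := E v;
    rewrite !ffunE.
rewrite -(card_imset (mem (Defs.aut H)) fi); apply: eq_card => s; rewrite !inE.
have im_comp (r : {perm V}) (e : {set V}) : f r @: e = t @: (r @: e).
  by rewrite -imset_comp; apply: eq_imset => v; rewrite /f ffunE.
apply/andP/imsetP => [[/injectiveP si /eqP[sV sE]]|[r rH ->]].
  have [|r rE] := factor_injection si ti; first by rewrite sV.
  have sf : s = f r by apply/ffunP => v; rewrite /f ffunE rE.
  exists r => //; rewrite inE; apply/eqP.
  apply: (imset_inj (imset_inj ti)); rewrite -[RHS]sE -[LHS]imset_comp.
  by apply: eq_imset => e /=; rewrite -im_comp sf.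
split.
  by apply/injectiveP => u v; rewrite !ffunE => /ti/perm_inj.
move: rH; rewrite inE => /eqP rH; apply/eqP; congr (_, _).
  by rewrite im_comp injection_surj //; exact: perm_inj.
rewrite /im_edges -[in RHS]rH -imset_comp; apply: eq_imset => e /=.
exact: im_comp.
Qed.

Lemma sum_embedding (R : pzSemiRingType) (H : sgraph V) (phi :
  {set W} * {set {set W}} -> R) :
  \sum_(s : {ffun V -> W} | injectiveb s) phi (embedding H s) =
  #|Defs.aut H|%:R * \sum_(C in [set embedding H (s :
    {ffun V -> W}) | s in [set s : {ffun V -> W} | injectiveb s]]) phi C.
Proof.
rewrite (partition_big (fun s : {ffun V -> W} => embedding H s)
  (mem [set embedding H (s : {ffun V -> W}) | s in [set s :
    {ffun V -> W} | injectiveb s]])) /=; last first.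
  by move=> s si; apply: imset_f; rewrite inE.
rewrite mulr_sumr; apply: eq_bigr => C /imsetP[t].
rewrite inE => /injectiveP ti ->.
rewrite (eq_bigr (fun=> phi (embedding H t)));
  last by move=> s /andP[_ /eqP ->].
by rewrite sumr_const mulr_natl -(embedding_fiber H ti) cardsE.
Qed.

End Embeddings.

Section Pullback.
Variables (V W : finType).

(** For an injection t, the graph induced by g on the image of t, transported
    to V. *)
Definition pullback_edges (t : V -> W) (g : sgraph W) : {set {set V}} :=
  [set e : {set V} | (#|e| == 2) && (t @: e \in edges g)].

Lemma pullback_subproof t g : [forall e in pullback_edges t g, #|e| == 2].
Proof. by apply/forall_inP => e; rewrite inE => /andP[]. Qed.

Definition pullback t g := SGraph (pullback_subproof t g).

(** The number of copies on a given vertex set depends only on the graph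
    induced there. *)
Lemma copies_on_image (H : sgraph V) (g : sgraph W) (t : {ffun V -> W}) :
  injective t ->
  #|[set C in copies H g | C.1 == t @: [set: V]]| = ncopies H (pullback t g).
Proof.
move=> ti.
pose f (C : {set V} * {set {set V}}) := (t @: C.1, im_edges t C.2).
have fi : injective f.
  by move=> [A E] [A' E'] [/(imset_inj ti) -> /(imset_inj (imset_inj ti)) ->].
rewrite /ncopies -(card_imset (mem (copies H (pullback t g))) fi).
have im_comp (r : V -> V) (e : {set V}) : (fun v =>
  t (r v)) @: e = t @: (r @: e).
  by rewrite -imset_comp.
have im_comp2 (r : V -> V) : im_edges (fun v => t (r v)) (edges H) =
    im_edges t [set r @: (e : {set V}) | e in edges H].
  by rewrite /im_edges -imset_comp; apply: eq_imset => e /=; rewrite im_comp.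
apply: eq_card => C; rewrite inE.
apply/andP/imsetP => [[/copiesP[s si [-> sg]] /eqP/= sV]|[C' /copiesP[r ri [->
  rg]] ->]].
  have [|r rE] := factor_injection si ti; first by rewrite sV.
  have sE : s =1 (fun v => t (r v)) by [].
  have sE1 (e : {set V}) : s @: e = t @: (r @: e).
    by rewrite -im_comp; exact: eq_imset.
  have sE2 : im_edges s (edges H) = im_edges t [set r @: (e :
    {set V}) | e in edges H].
    by rewrite -im_comp2; apply: eq_imset => e; exact: eq_imset.
  exists ([set: V], [set r @: (e : {set V}) | e in edges H]); last first.
    by rewrite /f /embedding /= sE2 sV.
  apply/copiesP; exists (finfun r); first by move=> u v;
    rewrite !ffunE => /perm_inj.
  have rE2 : im_edges (finfun r) (edges H) = [set r @: (e :
    {set V}) | e in edges H].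
    by apply: eq_imset => e; apply: eq_imset => v; rewrite ffunE.
  split; rewrite /embedding rE2.
    rewrite injection_surj //.
    by move=> u v; rewrite !ffunE => /perm_inj.
  apply/fintype.subsetP => _ /imsetP[e eH ->].
  rewrite inE card_imset ?(edge_card eH) /=; last exact: perm_inj.
  by apply: (fintype.subsetP sg); rewrite -sE1; apply: imset_f.
have rV := injection_surj ri.
rewrite /f /embedding /= rV; split => //; apply/copiesP.
exists (finfun (fun v => t (r v))); first by move=> u v;
  rewrite !ffunE => /ti/ri.
have E2 : im_edges (finfun (fun v =>
  t (r v))) (edges H) = im_edges t (im_edges r (edges H)).
  rewrite -im_comp2; apply: eq_imset => e; apply: eq_imset => v; exact: ffunE.
split.
  rewrite /embedding E2; congr (_, _).
  rewrite -[in LHS]rV -im_comp; apply: eq_imset => v; exact/esym/ffunE.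
rewrite E2; apply/fintype.subsetP => _ /imsetP[e /(fintype.subsetP rg) + ->].
by rewrite inE => /andP[].
Qed.

End Pullback.

Section Isomorphism.
Variables (V : finType).
Implicit Types F : sgraph V.

Lemma isosP F F' (s : {perm V}) :
  (s \in isos F F') = (im_edges s (edges F) == edges F').
Proof. by rewrite inE. Qed.

Lemma im_edgesM (s t : {perm V}) E :
  im_edges (s * t)%g E = im_edges t (im_edges s E).
Proof.
rewrite /im_edges -imset_comp; apply: eq_imset => e /=; rewrite -imset_comp.
by apply: eq_imset => v; rewrite permM.
Qed.

Lemma im_edges1 E : im_edges (1 : {perm V})%g E = E.
Proof.
rewrite /im_edges -[RHS]imset_id; apply: eq_imset => e /=.
by rewrite -[RHS]imset_id; apply: eq_imset => v; rewrite perm1.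
Qed.

Lemma isosV F F' s : s \in isos F F' -> (s^-1)%g \in isos F' F.
Proof. by rewrite !isosP => /eqP <-; rewrite -im_edgesM mulgV im_edges1. Qed.

Lemma isosM F1 F2 F3 s t : s \in isos F1 F2 -> t \in isos F2 F3 ->
  (s * t)%g \in isos F1 F3.
Proof. by rewrite !isosP im_edgesM => /eqP ->. Qed.

Lemma isomorphic_equiv : equivalence_rel (@isomorphic V).
Proof.
have sym F F' : isomorphic F F' -> isomorphic F' F.
  by case/set0Pn => s sF; apply/set0Pn; exists (s^-1)%g; exact: isosV.
have tr F1 F2 F3 : isomorphic F1 F2 -> isomorphic F2 F3 -> isomorphic F1 F3.
  by case/set0Pn => s sF /set0Pn[t tF]; apply/set0Pn; exists (s * t)%g;
    exact: isosM tF.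
move=> F1 F2 F3; split.
  by apply/set0Pn; exists 1%g; rewrite isosP im_edges1.
by move=> F12; apply/idP/idP; apply: tr => //; exact: sym.
Qed.

Lemma isomorphic_edges F F' : isomorphic F F' -> #|edges F| = #|edges F'|.
Proof.
case/set0Pn => s; rewrite isosP => /eqP <-; rewrite card_im_edges //;
  exact: perm_inj.
Qed.

Lemma isos_card F F' s : s \in isos F F' -> #|isos F F'| = #|Defs.aut F|.
Proof.
move=> sF; rewrite -(card_imset (mem (Defs.aut F)) (mulIg s));
  apply: eq_card => t.
apply/idP/imsetP => [tF|[r rF ->]]; last exact: isosM sF.
by exists (t * s^-1)%g; rewrite ?mulgKV //; apply: isosM tF _; exact: isosV.
Qed.

Lemma relabel_subproof (s : {perm V}) F : [forall e in im_edges s (edges F),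
  #|e| == 2].
Proof.
apply/forall_inP => _ /imsetP[e eF ->].
by rewrite card_imset ?(edge_card eF) //; exact: perm_inj.
Qed.

Definition relabel (s : {perm V}) F := SGraph (relabel_subproof s F).

(** Orbit counting for the permutations of the vertices: the permutations that
    send F to a given member of its class form a coset of Aut F. *)
Lemma isomorphism_class_card F :
  (#|[set F' | isomorphic F F']| * #|Defs.aut F| = #|V| `!)%N.
Proof.
have -> : #|V| `! = #|{: {perm V}}|.
  rewrite -(cardsT V) -card_perm; apply: eq_card => s; rewrite inE.
  by rewrite unfold_in /perm_on; apply/fintype.subsetP => v; rewrite inE.
have <- : (\sum_(F' in [set F' | isomorphic F F']) \sum_(s in isos F F') 1)%N =
  #|{: {perm V}}|.
  rewrite -sum1_card (partition_big (fun s : {perm V} =>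
    relabel s F) (mem [set F' | isomorphic F F'])) /=.
    apply: eq_bigr => F' _; apply: eq_bigl => s; rewrite isosP -val_eqE /=.
    by [].
  by move=> s _; rewrite inE; apply/set0Pn; exists s; rewrite isosP.
rewrite -sum_nat_const; apply: eq_bigr => F'; rewrite inE => /set0Pn[s sF].
by rewrite sum1_card (isos_card sF).
Qed.

Lemma isomorphic_ncopies (H : sgraph V) F F' :
  isomorphic F F' -> ncopies H F = ncopies H F'.
Proof.
case/set0Pn => s; rewrite isosP => /eqP sF.
pose t : {ffun V -> V} := finfun s.
have ti : injective t by move=> u v; rewrite !ffunE; exact: perm_inj.
have im_t (e : {set V}) : t @: e = s @: e by apply: eq_imset => v;
  rewrite ffunE.
transitivity (ncopies H (pullback t F')).
  congr ncopies; apply/val_inj/setP => e /=; rewrite inE im_t -sF.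
  apply/idP/andP => [eF|[_ /imsetP[e' eF /(imset_inj perm_inj) -> //]]].
  by rewrite (edge_card eF); split => //; apply: imset_f.
rewrite -copies_on_image //; apply: eq_card => C; rewrite inE.
case: (boolP (C \in copies H F')) => //= /copiesP[r ri [-> _]].
by rewrite /= !injection_surj // eqxx.
Qed.

Lemma ncopies_edges (H F : sgraph V) :
  (0 < ncopies H F)%N -> (#|edges H| <= #|edges F|)%N.
Proof.
rewrite card_gt0 => /set0Pn[C /copiesP[r ri [_ rF]]].
by rewrite -(card_im_edges (edges H) ri); exact: subset_leq_card.
Qed.

(** A copy with as many edges as F is all of F. *)
Lemma ncopies_le1 (H F : sgraph V) :
  #|edges H| = #|edges F| -> (ncopies H F <= 1)%N.
Proof.
move=> HF; rewrite -(cards1 ([set: V], edges F)); apply: subset_leq_card.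
apply/fintype.subsetP => C /copiesP[r ri [-> rF]]; rewrite inE; apply/eqP;
  congr (_, _).
  exact: injection_surj.
by apply/eqP; rewrite eqEcard rF card_im_edges //= HF leqnn.
Qed.

Lemma aut_gt0 F : (0 < #|Defs.aut F|)%N.
Proof. by rewrite card_gt0; apply/set0Pn; exists 1%g;
  rewrite isosP im_edges1. Qed.

End Isomorphism.

(** * The weighted space of coloured graphs *)

Section Outcomes.
Variables (R : realType) (n c : nat) (p : R).
Hypothesis p01 : 0 < p < 1.
Hypothesis c_gt0 : (0 < c)%N.

Notation outcome := (sgraph 'I_n * {ffun 'I_n -> 'I_c})%type.
Notation wt := (@outcome_weight R n c p).

Let graph_weight (g : sgraph 'I_n) : R :=
  \prod_(e : {set 'I_n} | #|e| == 2) (if e \in edges g then p else 1 - p).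

(** The edges are independent: summing a product over all graphs gives a
    product over all pairs of vertices. *)
Lemma sum_sgraph_prod (a : {set 'I_n} -> bool -> R) :
  \sum_g \prod_(e : {set 'I_n} | #|e| == 2) a e (e \in edges g) =
  \prod_(e : {set 'I_n} | #|e| == 2) (a e true + a e false).
Proof.
pose a1 (e : {set 'I_n}) := if #|e| == 2 then a e true else 0.
pose a0 (e : {set 'I_n}) := if #|e| == 2 then a e false else 1.
transitivity (\prod_e (a1 e + a0 e)); last first.
  rewrite [RHS]big_mkcond; apply: eq_bigr => e _; rewrite /a1 /a0.
  by case: eqP => // _; rewrite add0r.
rewrite bigA_distr (bigID (fun J : {set {set 'I_n}} =>
  [forall e in J, #|e| == 2])) /=.
rewrite [X in _ + X]big1 ?addr0; last first.
  move=> J /forall_inPn[e eJ e2]; rewrite (bigD1 e) //= eJ /a1 (negbTE e2).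
  by rewrite mul0r.
rewrite [RHS](reindex_omap (@edges 'I_n) insub) /=; last first.
  by move=> J J2; rewrite insubT /=.
apply: eq_big => [g|g _].
  rewrite edgesP /= (_ : edges g = val g) // valK; exact/esym/eqP.
rewrite [LHS]big_mkcond; apply: eq_bigr => e _; rewrite /a1 /a0.
case: (boolP (#|e| == 2)) => e2; first by case: (e \in edges g).
by case: (boolP (e \in edges g)) => // /edge_card e2'; rewrite e2' in e2.
Qed.

Lemma fexp_graph_coloring (f : sgraph 'I_n -> R) (h :
  {ffun 'I_n -> 'I_c} -> R) :
  fexp wt (fun o => f o.1 * h o.2) =
  fexp graph_weight f * fexp (fun=> \prod_(v < n) c%:R^-1) h.
Proof.
rewrite /fexp mulr_suml.
under [RHS]eq_bigr do rewrite mulr_sumr.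
rewrite pair_bigA; apply: eq_bigr => -[g x] _ /=.
by rewrite /outcome_weight mulrACA.
Qed.

Lemma fexp_edges (A B : {set {set 'I_n}}) :
  (forall e, e \in A -> #|e| = 2) -> (forall e,
    e \in B -> #|e| = 2) -> [disjoint A & B] ->
  fexp graph_weight (fun g => ((A \subset edges g) && [disjoint B & edges
    g])%:R) =
  p ^+ #|A| * (1 - p) ^+ #|B|.
Proof.
move=> A2 B2 dAB.
pose a (e : {set 'I_n}) (b : bool) : R :=
  if b then p * (e \notin B)%:R else (1 - p) * (e \notin A)%:R.
transitivity (\sum_g \prod_(e : {set 'I_n} | #|e| == 2) a e (e \in edges g)).
  apply: eq_bigr => g _.
  case: (boolP (A \subset edges g)) => [Ag|]; last first.
    case/fintype.subsetPn => e eA eg;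
      rewrite (bigD1 e) ?A2 //= /a (negbTE eg) eA.
    by rewrite !mulr0 mul0r.
  case: (boolP [disjoint B & edges g]) => [Bg|]; last first.
    rewrite -setI_eq0 => /set0Pn[e /setIP[eB eg]].
    by rewrite (bigD1 e) ?B2 //= /a eg eB !mulr0 mul0r.
  rewrite mulr1; apply: eq_bigr => e _; rewrite /a.
  case: (boolP (e \in edges g)) => eg.
    by have /negbT -> := disjointFl Bg eg; rewrite mulr1.
  by rewrite (contra (fintype.subsetP Ag e) eg) mulr1.
rewrite sum_sgraph_prod.
transitivity (\prod_(e : {set 'I_n} | #|e| == 2)
   ((if e \in A then p else 1) * (if e \in B then 1 - p else 1))).
  apply: eq_bigr => e _; rewrite /a.
  case: (boolP (e \in A)) => eA;
    first by rewrite (disjointFr dAB eA) !mulr1 mulr0 addr0.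
  by case: (boolP (e \in B)) => eB;
    rewrite !mulr1 ?mulr0 ?add0r ?mul1r // subrKC.
rewrite big_split /= -!big_mkcondr /= -!prodr_const; congr (_ * _).
  by apply: eq_bigl => e; apply: andb_idl => /A2 ->.
by apply: eq_bigl => e; apply: andb_idl => /B2 ->.
Qed.

Definition mono (S : {set 'I_n}) (x : {ffun 'I_n -> 'I_c}) :=
  [forall u in S, forall v in S, x u == x v].

(** Sum over the common colour a; for each a the vertices of S are forced. *)
Lemma fexp_mono (S : {set 'I_n}) : S != set0 ->
  fexp (fun=> \prod_(v < n) c%:R^-1) (fun x => (mono S x)%:R) =
  c%:R ^- #|S|.-1 :> R.
Proof.
case/set0Pn => u uS.
have c0 : c%:R != 0 :> R by rewrite pnatr_eq0 -lt0n.
transitivity (\sum_(a < c) \sum_(x : {ffun 'I_n -> 'I_c})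
    \prod_(v < n) (c%:R^-1 * ((v \in S) ==> (x v == a))%:R) : R).
  rewrite exchange_big; apply: eq_bigr => x _.
  under [RHS]eq_bigr => a _ do rewrite big_split /=.
  rewrite -mulr_sumr; congr (_ * _).
  have prodE a : \prod_v ((v \in S) ==> (x v == a))%:R =
       [forall v in S, x v == a]%:R :> R.
    case: (boolP [forall v in S, x v == a]) =>
      [/forall_inP xa|/forall_inPn[v vS xv]].
      by rewrite big1 // => v _; case: (boolP (v \in S)) => // /xa ->.
    by rewrite (bigD1 v) //= vS (negbTE xv) mul0r.
  under [RHS]eq_bigr do rewrite prodE.
  rewrite (bigD1 (x u)) //= big1 ?addr0 => [|a xa].
    congr (_%:R); congr nat_of_bool; apply/forall_inP/forall_inP =>
      [xS v vS|xS v vS].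
      by have /forall_inP/(_ u uS) := xS v vS.
    by apply/forall_inP => v' v'S; rewrite (eqP (xS v vS)) (eqP (xS v' v'S)).
  case: forall_inP => // /(_ u uS); by rewrite eq_sym (negbTE xa).
transitivity (\sum_(a < c) \prod_(v < n) (if v \in S then c%:R^-1 else 1) : R).
  apply: eq_bigr => a _; rewrite -(bigA_distr_bigA (fun v b =>
    c%:R^-1 * ((v \in S) ==> (b == a))%:R)).
  apply: eq_bigr => v _; rewrite -mulr_sumr; case: (v \in S) => /=.
    rewrite (bigD1 a) //= eqxx big1 ?addr0 ?mulr1 // => b /negbTE -> //.
  by rewrite sumr_const card_ord mulVf.
rewrite -big_mkcond /= prodr_const sumr_const card_ord -[LHS]mulr_natl -exprVn.
have : (0 < #|S|)%N by rewrite card_gt0; apply/set0Pn; exists u.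
by case: #|S| => // m _; rewrite exprS mulrA mulfV // mul1r.
Qed.

Lemma fexp_edges_mono (A B : {set {set 'I_n}}) (S : {set 'I_n}) :
  (forall e, e \in A -> #|e| = 2) -> (forall e,
    e \in B -> #|e| = 2) -> [disjoint A & B] ->
  S != set0 ->
  fexp wt (fun o => ((A \subset edges o.1) && [disjoint B & edges o.1])%:R
                    * (mono S o.2)%:R) =
  p ^+ #|A| * (1 - p) ^+ #|B| * c%:R ^- #|S|.-1.
Proof.
move=> A2 B2 dAB S0.
rewrite (fexp_graph_coloring
  (fun g => ((A \subset edges g) && [disjoint B & edges g])%:R) (fun x =>
    (mono S x)%:R)).
by rewrite fexp_edges // fexp_mono.
Qed.

Lemma weight_ge0 o : 0 <= wt o.
Proof.
case/andP: p01 => p0 p1.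
rewrite mulr_ge0 ?prodr_ge0 // => e _.
by case: ifP => _; rewrite ?subr_ge0 ltW.
Qed.

Lemma weight_sum : \sum_o wt o = 1.
Proof.
transitivity (fexp wt (fun=> 1 * 1)); first by apply: eq_bigr => o _;
  rewrite !mulr1.
rewrite (fexp_graph_coloring (fun=> 1) (fun=> 1)).
have -> : fexp graph_weight (fun=> 1) = 1.
  rewrite /fexp; under eq_bigr do rewrite mulr1.
  rewrite (sum_sgraph_prod (fun _ b => if b then p else 1 - p)).
  by rewrite big1 // => e _; rewrite subrKC.
rewrite mul1r /fexp; under eq_bigr do rewrite mulr1.
rewrite -(bigA_distr_bigA (fun (_ : 'I_n) (_ : 'I_c) => c%:R^-1)) big1 // =>
  v _.
by rewrite sumr_const card_ord -[LHS]mulr_natl mulfV // pnatr_eq0 -lt0n.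
Qed.

Definition agree_in (S : {set 'I_n}) (o o' : outcome) : Prop :=
  (forall e : {set 'I_n}, e \subset S -> (e \in edges o.1) = (e \in edges
    o'.1)) /\
  {in S, o.2 =1 o'.2}.

Definition agree_out (S : {set 'I_n}) (o o' : outcome) : Prop :=
  (forall e : {set 'I_n}, ~~ (e \subset S) -> (e \in edges o.1) = (e \in edges
    o'.1)) /\
  (forall v, v \notin S -> o.2 v = o'.2 v).

Definition mix_edges (S : {set 'I_n}) (g g' : sgraph 'I_n) : {set {set 'I_n}} :=
  [set e : {set 'I_n} | if e \subset S then e \in edges g else e \in edges g'].

Lemma mix_subproof S g g' : [forall e in mix_edges S g g', #|e| == 2].
Proof.
by apply/forall_inP => e; rewrite inE; case: ifP => _ /edge_card ->.
Qed.

Definition mix S (o o' : outcome) : outcome :=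
  (SGraph (mix_subproof S o.1 o'.1), [ffun v =>
    if v \in S then o.2 v else o'.2 v]).

Lemma mix_in S o o' : agree_in S (mix S o o') o.
Proof.
split => [e eS|v vS] /=; first by rewrite inE eS.
by rewrite ffunE vS.
Qed.

Lemma mix_out S o o' : agree_out S (mix S o o') o'.
Proof.
split => [e eS|v vS] /=; first by rewrite inE (negbTE eS).
by rewrite ffunE (negbTE vS).
Qed.

Lemma mixK S o o' : mix S (mix S o o') (mix S o' o) = o.
Proof.
case: o o' => [g x] [g' x'] /=; congr (_, _).
  by apply/val_inj/setP => e; rewrite !inE; case: (e \subset S).
by apply/ffunP => v; rewrite !ffunE; case: (v \in S).
Qed.

Lemma weight_mix S o o' : wt (mix S o o') * wt (mix S o' o) = wt o * wt o'.
Proof.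
rewrite /outcome_weight mulrACA [RHS]mulrACA; congr (_ * _).
rewrite -!big_split; apply: eq_bigr => e _ /=; rewrite !inE.
by case: (e \subset S); rewrite // mulrC.
Qed.

(** Exchanging the parts outside S of two independent outcomes preserves their
    joint weight, and turns f(o) h(o') into f(o) h(o) when f depends only on the
    inside of S and h only on the outside. *)
Lemma fexp_indep S (f h : outcome -> R) :
  (forall o o', agree_in S o o' -> f o = f o') ->
  (forall o o', agree_out S o o' -> h o = h o') ->
  fexp wt (fun o => f o * h o) = fexp wt f * fexp wt h.
Proof.
move=> fS hS.
transitivity (\sum_(o : outcome * outcome) wt o.1 * wt o.2 * (f o.1 * h o.2));
  last first.
  rewrite /fexp mulr_suml; under [RHS]eq_bigr do rewrite mulr_sumr.
  by rewrite pair_bigA; apply: eq_bigr => -[x y] _ /=; rewrite mulrACA.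
pose swap (o : outcome * outcome) := (mix S o.1 o.2, mix S o.2 o.1).
have swapK : involutive swap.
  by case=> o1 o2; rewrite /swap /= !mixK.
rewrite (reindex_inj (can_inj swapK)) /=.
under [RHS]eq_bigr => o _.
  rewrite weight_mix (fS _ _ (mix_in S _ _)) (hS _ _ (mix_out S _ _)) mulrAC;
    over.
rewrite -(pair_bigA _ (fun o o' => wt o * (f o * h o) * wt o')) /=.
by apply: eq_bigr => o _; rewrite -mulr_sumr weight_sum mulr1.
Qed.

End Outcomes.

(** * Clumps of monochromatic copies *)

Section Clumps.
Variables (R : realType) (V : finType) (H : sgraph V) (n c : nat) (p : R).
Hypothesis p01 : 0 < p < 1.
Hypothesis c_gt0 : (0 < c)%N.
Hypothesis V_gt0 : (0 < #|V|)%N.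

Notation outcome := (sgraph 'I_n * {ffun 'I_n -> 'I_c})%type.
Notation wt := (@outcome_weight R n c p).
Local Notation E := (fexp wt).

Definition clump (S : {set 'I_n}) (o : outcome) : nat :=
  if mono S o.2 then #|[set C in copies H o.1 | C.1 == S]| else 0.

Definition present (s : V -> 'I_n) (o : outcome) : bool :=
  (im_edges s (edges H) \subset edges o.1) && mono (s @: [set: V]) o.2.

Lemma sum_present S o :
  \sum_(s : {ffun V -> 'I_n} | injectiveb s && (s @: [set: V] == S))
     (present s o)%:R = #|Defs.aut H|%:R * (clump S o)%:R :> R.
Proof.
pose phi (C : {set 'I_n} * {set {set 'I_n}}) : R :=
  [&& C.1 == S, C.2 \subset edges o.1 & mono C.1 o.2]%:R.
transitivity (\sum_(s : {ffun V -> 'I_n} | injectiveb s) phi (embedding H s)).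
  rewrite big_mkcondr; apply: eq_bigr => s _; rewrite /phi /present /=.
  by case: (_ == S).
rewrite sum_embedding /phi /clump; congr (_ * _).
rewrite -natr_sum -big_mkcondr sum1_card; congr (_%:R).
case: ifP => Sx; last first.
  apply: eq_card0 => C; rewrite unfold_in /=.
  by case: eqP => [->|]; rewrite ?Sx ?andbF.
apply: eq_card => C; rewrite unfold_in [RHS]inE /=; case: eqP => [CS|];
  last by rewrite !andbF.
rewrite CS Sx !andbT /=; apply/andP/copiesP =>
  [[/imsetP[s + ->] Cg]|[s si [-> Cg]]].
  by rewrite inE => /injectiveP si; exists s.
by split => //; apply/imsetP; exists s; rewrite // inE; exact/injectiveP.
Qed.

Lemma prod_edges_present (s : {ffun V -> 'I_n}) (o : outcome) :
  (\prod_(e in edges H) ((s @: (e : {set V})) \in edges o.1)%:R)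
    * [forall a, forall b, o.2 (s a) == o.2 (s b)]%:R = (present s o)%:R :> R.
Proof.
have -> : [forall a, forall b, o.2 (s a) == o.2 (s b)] = mono (s @: [set:
  V]) o.2.
  apply/forallP/forall_inP => [xs _ /imsetP[a _ ->]|xs a].
    by apply/forall_inP => _ /imsetP[b _ ->]; have /forallP/(_ b) := xs a.
  apply/forallP => b; have /forall_inP := xs (s a) (imset_f _ (finset.in_setT
    _)).
  by apply; apply: imset_f; exact: finset.in_setT.
have -> : \prod_(e in edges H) ((s @: (e : {set V})) \in edges o.1)%:R =
   (im_edges s (edges H) \subset edges o.1)%:R :> R.
  case: (boolP (im_edges s (edges H) \subset edges o.1)) =>
    [sg|/fintype.subsetPn[_ /imsetP[e eH ->] sg]].
    by rewrite big1 // => e eH; rewrite (fintype.subsetP sg) //; exact: imset_f.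
  by rewrite (bigD1 e) //= (negbTE sg) mul0r.
by rewrite /present; case: (_ \subset _); rewrite ?mul1r ?mul0r.
Qed.

Lemma mono_copies_sum (o : outcome) :
  mono_copies R H o.1 o.2 =
  #|Defs.aut H|%:R^-1 * \sum_(s :
    {ffun V -> 'I_n} | injectiveb s) (present s o)%:R.
Proof. by congr (_ * _); apply: eq_bigr => s _; exact: prod_edges_present. Qed.

(** In particular the count is a natural number, although it is defined with a
    division by |Aut H|. *)
Lemma mono_copiesE (o : outcome) :
  mono_copies R H o.1 o.2 = (\sum_S clump S o)%N%:R.
Proof.
rewrite mono_copies_sum (partition_big (fun s : {ffun V -> 'I_n} =>
  s @: [set: V]) xpredT) //=.
rewrite natr_sum mulr_sumr; apply: eq_bigr => S _.
by rewrite sum_present mulKf // pnatr_eq0 -lt0n aut_gt0.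
Qed.

Lemma clump_agree_in S o o' : agree_in S o o' -> clump S o = clump S o'.
Proof.
suff half o1 o2 : agree_in S o1 o2 -> (clump S o1 <= clump S o2)%N.
  move=> oo'; apply/eqP; rewrite eqn_leq !half //.
  by case: oo' => oe ov; split => [e eS|v vS]; rewrite ?oe ?ov.
case=> oe ov; rewrite /clump.
have -> : mono S o1.2 = mono S o2.2.
  by apply: eq_forallb_in => u uS; apply: eq_forallb_in => v vS; rewrite !ov.
case: ifP => // _; apply: subset_leq_card; apply/fintype.subsetP => C.
case/setIdP => /copiesP[s si [CE sg]] /eqP CS.
have sS : s @: [set: V] = S by rewrite -CS CE.
apply/setIdP; split; last by rewrite CS.
apply/copiesP; exists s => //; split => //.
apply/fintype.subsetP => e es; rewrite -oe; first exact: (fintype.subsetP sg).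
case/imsetP: es => e' _ ->; rewrite -sS; apply: imsetS; exact: finset.subsetT.
Qed.

(** A pair of vertices of S' lies outside any S disjoint from S'. *)
Lemma agree_out_in (S S' : {set 'I_n}) (o o' : outcome) : [disjoint S & S'] ->
  agree_out S o o' -> agree_in S' o o'.
Proof.
move=> SS' [oe ov]; split => [e eS'|v vS']; last by apply: ov;
  rewrite (disjointFl SS' vS').
case: (boolP (e \subset S)) => [eS|]; last exact: oe.
have /eqP -> : e == set0.
  by move: SS'; rewrite -setI_eq0 => /eqP S0;
    rewrite -finset.subset0 -S0 finset.subsetI eS.
suff e0 (g : sgraph 'I_n) : (set0 \in edges g) = false by rewrite !e0.
by apply/negP => /edge_card; rewrite cards0.
Qed.

Lemma clump_small (S : {set 'I_n}) (o : outcome) :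
  #|S| != #|V| -> clump S o = 0%N.
Proof.
move=> SV; rewrite /clump; case: ifP => // _; apply/eqP; rewrite cards_eq0.
apply/set0Pn => -[C /setIdP[/copiesP[s si [-> _]] /= /eqP sS]].
by rewrite -sS card_imset // cardsT eqxx in SV.
Qed.

Lemma exists_injection (S : {set 'I_n}) : #|S| = #|V| ->
  exists2 s : {ffun V -> 'I_n}, injective s & s @: [set: V] = S.
Proof.
move=> SV.
pose s := [ffun v : V => enum_val (cast_ord (esym SV) (enum_rank v))].
have si : injective s by move=> u v; rewrite !ffunE =>
  /enum_val_inj/cast_ord_inj/enum_rank_inj.
exists s => //; apply/eqP; rewrite eqEcard card_imset // cardsT SV leqnn andbT.
by apply/fintype.subsetP => _ /imsetP[v _ ->]; rewrite ffunE enum_valP.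
Qed.

Lemma clump_image (s : {ffun V -> 'I_n}) o : injective s ->
  clump (s @: [set: V]) o =
  if mono (s @: [set: V]) o.2 then ncopies H (pullback s o.1) else 0%N.
Proof. by move=> si; rewrite /clump copies_on_image. Qed.

Definition clump_bound := #|{: {set V} * {set {set V}}}|.

Lemma clump_le (S : {set 'I_n}) (o : outcome) : (clump S o <= clump_bound)%N.
Proof.
have [SV|SV] := eqVneq #|S| #|V|; last by rewrite clump_small.
have [s si <-] := exists_injection SV.
by rewrite clump_image //; case: ifP => // _; exact: max_card.
Qed.

Let image_n0 (s : {ffun V -> 'I_n}) : s @: [set: V] != set0.
Proof.
case/card_gt0P: V_gt0 => v _; apply/set0Pn; exists (s v).
by apply: imset_f; exact: finset.in_setT.
Qed.

Lemma im_edges_card2 (s : {ffun V -> 'I_n}) F : injective s ->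
  forall e, e \in im_edges s (edges F) -> #|e| = 2.
Proof. by move=> si _ /imsetP[e eF ->];
  rewrite card_imset // (edge_card eF). Qed.

Lemma fexp_present (s : {ffun V -> 'I_n}) : injective s ->
  E (fun o => (present s o)%:R) = p ^+ #|edges H| * c%:R ^- #|V|.-1.
Proof.
move=> si; have := @fexp_edges_mono R n c p c_gt0 (im_edges s (edges H)) set0
  (s @: [set: V]) (@im_edges_card2 s H si) _ _ (image_n0 s).
rewrite cards0 expr0 mulr1 card_im_edges // card_imset // cardsT => <-.
- apply: fexp_eq => o; rewrite /present -natrM mulnb; congr (nat_of_bool _)%:R.
  by rewrite -setI_eq0 finset.set0I eqxx andbT.
- by move=> e; rewrite inE.
- by rewrite -setI_eq0 finset.setI0.
Qed.

(** When the two images meet, both are monochromatic exactly if their union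
    is, which accounts for the exponent of c. *)
Lemma fexp_present2 (s t : {ffun V -> 'I_n}) : injective s -> injective t ->
  s @: [set: V] :&: t @: [set: V] != set0 ->
  E (fun o => (present s o)%:R * (present t o)%:R) =
  p ^+ #|im_edges s (edges H) :|: im_edges t (edges H)|
    * c%:R ^- #|s @: [set: V] :|: t @: [set: V]|.-1.
Proof.
move=> si ti /set0Pn[u /setIP[us ut]].
have U0 : s @: [set: V] :|: t @: [set: V] != set0.
  by apply/set0Pn; exists u; rewrite inE us.
have := @fexp_edges_mono R n c p c_gt0 (im_edges s (edges H) :|:
  im_edges t (edges H)) set0 _ _ _ _ U0.
rewrite cards0 expr0 mulr1 => <-.
- apply: fexp_eq => o; rewrite -!natrM !mulnb; congr (nat_of_bool _)%:R.
  rewrite -[X in _ && X && _]setI_eq0 finset.set0I eqxx andbT finset.subUset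
    /present.
  rewrite andbACA; congr (_ && _); apply/andP/forall_inP =>
    [[/forall_inP xs /forall_inP xt]|xU].
    have xE v : v \in s @: [set: V] :|: t @: [set: V] -> o.2 v = o.2 u.
      case/setUP => [vs|vt].
        by have /forall_inP/(_ _ us)/eqP := xs v vs.
      by have /forall_inP/(_ _ ut)/eqP := xt v vt.
    by move=> v vU; apply/forall_inP => v' v'U; rewrite !xE.
  split; apply/forall_inP => v vs; apply/forall_inP => v' v's.
    by have /forall_inP := xU v (fintype.subsetP (finset.subsetUl _ _) _ vs);
      apply; rewrite inE v's.
  by have /forall_inP := xU v (fintype.subsetP (finset.subsetUr _ _) _ vs);
    apply; rewrite inE v's orbT.
- by move=> e /setUP[]; exact: im_edges_card2.
- by move=> e; rewrite inE.
- by rewrite -setI_eq0 finset.setI0.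
Qed.

Lemma fexp_pullback (s : {ffun V -> 'I_n}) F : injective s ->
  E (fun o => (pullback s o.1 == F)%:R * (mono (s @: [set: V]) o.2)%:R) =
  p ^+ #|edges F| * (1 - p) ^+ ('C(#|V|, 2) - #|edges F|) * c%:R ^- #|V|.-1.
Proof.
move=> si.
pose D := [set e : {set V} | #|e| == 2].
have FD : edges F \subset D by apply/fintype.subsetP => e /edge_card eF;
  rewrite inE eF.
have D2 e : e \in im_edges s (D :\: edges F) -> #|e| = 2.
  by case/imsetP => e' + ->; rewrite card_imset // !inE => /andP[_ /eqP].
have dFD : [disjoint im_edges s (edges F) & im_edges s (D :\: edges F)].
  rewrite -setI_eq0 -imsetI; last by move=> ? ? _ _; exact: imset_inj.
  rewrite (_ : _ :&: _ = set0) ?imset0 //; apply/setP => e.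
  by rewrite !inE; case: (e \in edges F).
have := @fexp_edges_mono R n c p c_gt0 (im_edges s (edges F))
   (im_edges s (D :\: edges F)) _ (@im_edges_card2 s F si) D2 dFD (image_n0 s).
rewrite !card_im_edges // card_imset // cardsT cardsD (finset.setIidPr FD)
  card_draws => <-.
apply: fexp_eq => o; congr ((nat_of_bool _)%:R * _).
apply/eqP/andP => [<-|[Fg Dg]].
  split; first by apply/fintype.subsetP => _ /imsetP[e + ->];
    rewrite inE => /andP[].
  rewrite disjoint_subset; apply/fintype.subsetP => _ /imsetP[e + ->].
  by rewrite !inE; case: (#|e| == 2); rewrite //= andbT.
apply/val_inj/setP => e /=; rewrite inE.
apply/andP/idP => [[e2 eg]|eF]; last first.
  by rewrite (edge_card eF); split => //; apply: (fintype.subsetP Fg);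
    exact: imset_f.
apply/negPn/negP => eF.
have : s @: e \in im_edges s (D :\: edges F) by apply: imset_f; rewrite !inE eF.
by move/(disjointFr Dg); rewrite eg.
Qed.

(** The probability that the random graph on the vertices of H contains exactly
    j copies of H. *)
Definition clump_density (j : nat) : R :=
  \sum_(F : sgraph V | ncopies H F == j)
     p ^+ #|edges F| * (1 - p) ^+ ('C(#|V|, 2) - #|edges F|).

Lemma fexp_clump_eq (S : {set 'I_n}) j : (0 < j)%N -> #|S| = #|V| ->
  E (fun o => (clump S o == j)%:R) = clump_density j * c%:R ^- #|V|.-1.
Proof.
move=> j0 SV; have [s si <-] := exists_injection SV.
rewrite /clump_density mulr_suml.
under [RHS]eq_bigr do rewrite -(fexp_pullback _ si).
rewrite -fexp_sum; apply: fexp_eq => o; rewrite clump_image //.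
rewrite -mulr_suml; case: ifP => _;
  last by rewrite mulr0 eq_sym -[j == 0]negbK -lt0n j0.
rewrite mulr1; case: (boolP (_ == j)) => Nj.
  rewrite (bigD1 (pullback s o.1)) //= eqxx big1 ?addr0 // =>
    F /andP[_ /negbTE].
  by rewrite eq_sym => ->.
rewrite big1 // => F NF; case: eqP => // E; by rewrite E NF in Nj.
Qed.

Lemma sum_fexp_clump_eq j : (0 < j)%N ->
  \sum_S E (fun o => (clump S o == j)%:R) =
  'C(n, #|V|)%:R * (clump_density j * c%:R ^- #|V|.-1).
Proof.
move=> j0; rewrite (bigID (fun S : {set 'I_n} => #|S| == #|V|)) /=.
rewrite [X in _ + X]big1 ?addr0; last first.
  move=> S SV; rewrite /fexp big1 // => o _; rewrite clump_small //.
  by rewrite eq_sym -[j == 0]negbK -lt0n j0 mulr0.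
under eq_bigr => S /eqP SV do rewrite fexp_clump_eq //.
rewrite sumr_const mulr_natl; congr (_ *+ _).
have -> : 'C(n, #|V|) = #|[set S : {set 'I_n} | #|S| == #|V|]|.
  by rewrite card_draws card_ord.
by apply: eq_card => S; rewrite inE.
Qed.

Lemma fexp_mono_copies :
  E (fun o => mono_copies R H o.1 o.2) =
  #|Defs.aut H|%:R^-1 * (n ^_ #|V|)%:R * (p ^+ #|edges H| * c%:R ^- #|V|.-1).
Proof.
rewrite (fexp_eq _ mono_copies_sum) fexpZ -mulrA; congr (_ * _).
rewrite fexp_sum; under eq_bigr => s /injectiveP si do rewrite fexp_present //.
rewrite sumr_const mulr_natl; congr (_ *+ _).
have -> : n ^_ #|V| = #|[set s : {ffun V -> 'I_n} | injectiveb s]|.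
  by rewrite card_inj_ffuns card_ord.
by apply: eq_card => s; rewrite inE.
Qed.

(** The number of k-sets and the powers of c are eliminated in favour of the
    mean, whose limit is known.  The exponents are natural subtractions, exact
    because a graph with j > 0 copies of H has at least as many edges as H. *)
Lemma clump_coeff j : (0 < j)%N ->
  \sum_S E (fun o => (clump S o == j)%:R) =
  E (fun o => mono_copies R H o.1 o.2) * (#|Defs.aut H|%:R / (#|V| `!)%:R) *
  \sum_(F : sgraph V | ncopies H F == j)
     p ^+ (#|edges F| - #|edges H|) * (1 - p) ^+ ('C(#|V|, 2) - #|edges F|).
Proof.
move=> j0; rewrite sum_fexp_clump_eq // fexp_mono_copies.
have a0 : #|Defs.aut H|%:R != 0 :> R by rewrite pnatr_eq0 -lt0n aut_gt0.
have f0 : (#|V| `!)%:R != 0 :> R by rewrite pnatr_eq0 -lt0n fact_gt0.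
rewrite -bin_ffact natrM.
have -> : clump_density j = p ^+ #|edges H| *
  \sum_(F : sgraph V | ncopies H F == j)
     p ^+ (#|edges F| - #|edges H|) * (1 - p) ^+ ('C(#|V|, 2) - #|edges F|).
  rewrite mulr_sumr; apply: eq_bigr => F /eqP NF.
  by rewrite mulrA -exprD subnKC // ncopies_edges // NF.
move: (\sum_(_ | _) _) (c%:R ^- _) (p ^+ _) => x y z.
move: (#|Defs.aut H|%:R : R) (_`!%:R : R) ('C(n, #|V|)%:R : R) a0 f0 =>
  a f b a0 f0.
by field; rewrite a0 f0.
Qed.

End Clumps.

(** * Overlapping pairs of copies *)

(** Comparison of the contribution of pairs that share i vertices with the mean
    scale.  Taking k-th powers clears the denominator of e i / k, and leaves
    a power of c equal to i - k, which is negative. *)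
Lemma scale_pow_le (R : realType) (k e i : nat) (x p c B : R) :
  0 <= x -> 0 <= p -> p <= 1 -> 1 <= c -> (0 < i < k)%N -> 1 <= B ->
  x ^+ k * (p ^+ e * c ^- k.-1) <= B ->
  (x ^+ (k + (k - i)) * (p ^+ (2 * e - (e * i) %/ k) * c ^- (k + (k - i)).-1))
    ^+ k
    <= B ^+ (2 * k) / c.
Proof.
move=> x0 p0 p1 c1 /andP[i0 ik] B1; set s := x ^+ k * _ => sB.
pose m := (k - i)%N.
have m0 : (0 < m)%N by rewrite subn_gt0.
have c0 : 0 < c by apply: lt_le_trans c1.
have s0 : 0 <= s by rewrite /s !mulr_ge0 ?invr_ge0 ?exprn_ge0 // (ltW c0).
have step : (x ^+ (k + m) * (p ^+ (2 * e - (e * i) %/ k) * c ^- (k + m).-1)) ^+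
  k
    <= s ^+ (k + m) / c ^+ m.
  rewrite /s !exprMn -!exprVn -!exprM -!mulrA [((k + m) * k)%N]mulnC -exprD.
  have -> : (k.-1 * (k + m) + m = (k + m).-1 * k)%N by rewrite /m; nia.
  rewrite ler_wpM2l ?exprn_ge0 // ler_wpM2r ?exprn_ge0 ?invr_ge0 ?(ltW c0) //.
  apply: ler_wiXn2l => //.
  rewrite mulnBl.
  have := leq_divM (e * i) k.
  rewrite /m; nia.
apply: le_trans step _.
apply: ler_pM; rewrite ?exprn_ge0 ?invr_ge0 ?exprn_ge0 ?(ltW c0) //.
  apply: (@le_trans _ _ (B ^+ (k + m))); first by apply: lerXn2r;
    rewrite ?nnegrE ?(le_trans ler01 B1).
  by apply: ler_weXn2l => //; rewrite /m; lia.
rewrite lef_pV2 ?posrE ?exprn_gt0 //.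
by rewrite -[leLHS]expr1; apply: ler_weXn2l.
Qed.

Section Overlap.
Variables (R : realType) (V : finType) (H : sgraph V) (n c : nat) (p : R).
Hypothesis p01 : 0 < p < 1.
Hypothesis c_gt0 : (0 < c)%N.
Hypothesis V_gt0 : (0 < #|V|)%N.
Hypothesis H_balanced : balanced H.

Notation outcome := (sgraph 'I_n * {ffun 'I_n -> 'I_c})%type.
Notation wt := (@outcome_weight R n c p).
Local Notation E := (fexp wt).
Local Notation k := #|V|.
Local Notation im s := ((s : V -> 'I_n) @: [set: V]).
Local Notation clump := (@clump V H n c).
Local Notation present := (@present V H n c).

(** The definition of balancedness, cleared of denominators. *)
Lemma balanced_subgraph (A : {set V}) (D : {set {set V}}) :
  A != set0 -> D \subset edges H -> (forall e, e \in D -> e \subset A) ->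
  (#|D| * #|V| <= #|edges H| * #|A|)%N.
Proof.
move=> A0 DH DA.
have : #|D|%:R / #|A|%:R <= max_density H.
  apply: (bigmax_sup (A, D)) => //=.
  by rewrite A0 andbT /subgraph DH; apply/forall_inP => e /DA.
rewrite H_balanced => DV.
have A0' : 0 < #|A|%:R :> rat by rewrite ltr0n card_gt0.
have V0' : 0 < #|V|%:R :> rat by rewrite ltr0n.
by move: DV; rewrite ler_pdivrMr // mulrAC ler_pdivlMr // -!natrM ler_nat.
Qed.

(** The overlap of the two images, read off in the domain of t. *)
Definition shared (s t : V -> 'I_n) : {set V} := [set v | t v \in im s].

Lemma shared_image s t : injective t -> #|im s :&: im t| = #|shared s t|.
Proof.
move=> ti; rewrite -(card_imset _ ti); apply: eq_card => u.
apply/setIP/imsetP => [[us /imsetP[v _ uv]]|[v + ->]].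
  by exists v => //; rewrite inE -uv.
by rewrite inE => vs; split => //; apply: imset_f; exact: finset.in_setT.
Qed.

(** The common edges of two copies form a subgraph of H on the shared
    vertices. *)
Lemma shared_edges s t : injective t -> shared s t != set0 ->
  (#|im_edges s (edges H) :&: im_edges t (edges H)| * #|V|
     <= #|edges H| * #|shared s t|)%N.
Proof.
move=> ti A0.
pose D := [set e in edges H | t @: (e : {set V}) \in im_edges s (edges H)].
have -> : im_edges s (edges H) :&: im_edges t (edges H) = im_edges t D.
  apply/setP => u; apply/setIP/imsetP => [[us /imsetP[e eH ue]]|[e + ->]].
    by exists e => //; rewrite inE eH -ue.
  by rewrite inE => /andP[eH es]; split => //; apply: imset_f.
rewrite card_im_edges //; apply: balanced_subgraph => //.
  by apply/fintype.subsetP => e; rewrite inE => /andP[].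
move=> e; rewrite inE => /andP[_ /imsetP[e' _ te]].
apply/fintype.subsetP => v ve; rewrite inE.
have : t v \in t @: e by exact: imset_f.
by rewrite te => /imsetP[v' _ ->]; apply: imset_f; exact: finset.in_setT.
Qed.

(** Given s and A, each vertex of A goes to one of the k vertices of the image
    of s, and the others are free. *)
Lemma card_shared_fiber (s : {ffun V -> 'I_n}) (A : {set V}) : injective s ->
  (#|[set t : {ffun V -> 'I_n} | shared s t == A]| <= k ^ k * n ^ (k - #|A|))%N.
Proof.
move=> si.
pose F v : {set 'I_n} := if v \in A then im s else setT.
apply: (@leq_trans #|family F|).
  apply: subset_leq_card; apply/fintype.subsetP => t; rewrite inE => /eqP tA.
  apply/familyP => v; rewrite /F -tA inE; case: ifP => //.
have -> : #|family F| = (\prod_v #|F v|)%N by rewrite card_family foldrE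
  big_map big_enum.
rewrite (bigID (mem A)) /=.
rewrite (eq_bigr (fun=> k)) => [|v vA];
  last by rewrite /F vA card_imset // cardsT.
rewrite [X in (_ * X <= _)%N](eq_bigr (fun=> n)) => [|v vA]; last first.
  by rewrite /F (negbTE vA) cardsT card_ord.
rewrite !prod_nat_const.
have -> : #|[pred v | v \notin A]| = (k - #|A|)%N.
  by rewrite -(cardC A) addKn; apply: eq_card => v; rewrite !inE.
by rewrite leq_mul2r leq_pexp2l ?orbT // max_card.
Qed.

Lemma sum_injections (q : rel {set 'I_n}) (f :
  {ffun V -> 'I_n} -> {ffun V -> 'I_n} -> R) :
  \sum_S \sum_(S' | q S S')
     \sum_(s : {ffun V -> 'I_n} | injectiveb s && (im s == S))
        \sum_(t : {ffun V -> 'I_n} | injectiveb t && (im t == S')) f s t =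
  \sum_(s : {ffun V -> 'I_n} | injectiveb s)
     \sum_(t : {ffun V -> 'I_n} | injectiveb t && q (im s) (im t)) f s t.
Proof.
rewrite [RHS](partition_big (fun s : {ffun V -> 'I_n} => im s) xpredT) //=.
apply: eq_bigr => S _; rewrite exchange_big /=;
  apply: eq_bigr => s /andP[_ /eqP sS].
rewrite sS [RHS](partition_big (fun t : {ffun V -> 'I_n} => im t) (q S)) /=;
  last first.
  by move=> t /andP[].
apply: eq_bigr => S' SS'; apply: eq_bigl => t.
by case: eqP => [->|]; rewrite ?SS' ?andbF ?andbT.
Qed.

Lemma sum_shared_le (q : pred {set V}) (phi : {set V} -> R) :
  (forall A, 0 <= phi A) ->
  \sum_(s : {ffun V -> 'I_n} | injectiveb s)
     \sum_(t : {ffun V -> 'I_n} | injectiveb t && q (shared s t)) phi (shared s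
       t) <=
  \sum_(A | q A) (k ^ k)%:R * (n%:R ^+ (k + (k - #|A|)) * phi A).
Proof.
move=> phi0.
have inner (s : {ffun V -> 'I_n}) : injective s ->
  \sum_(t : {ffun V -> 'I_n} | injectiveb t && q (shared s t)) phi (shared s t)
    <=
  \sum_(A | q A) (k ^ k)%:R * (n%:R ^+ (k - #|A|) * phi A).
  move=> si.
  apply: (@le_trans _ _ (\sum_(t :
    {ffun V -> 'I_n} | q (shared s t)) phi (shared s t))).
    by rewrite big_mkcondl; apply: ler_sum => t _; case: ifP.
  rewrite (partition_big (fun t : {ffun V -> 'I_n} => shared s t) q) //=.
  apply: ler_sum => A _.
  rewrite (eq_bigr (fun=> phi A)) => [|t /andP[_ /eqP ->] //].
  rewrite sumr_const -[phi A *+ _]mulr_natl mulrA ler_wpM2r //.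
  rewrite -natrX -natrM ler_nat; apply: leq_trans (card_shared_fiber A si).
  apply: subset_leq_card; apply/fintype.subsetP => t; rewrite unfold_in inE.
  by case/andP.
apply: (@le_trans _ _ (\sum_(s : {ffun V -> 'I_n} | injectiveb s)
   \sum_(A | q A) (k ^ k)%:R * (n%:R ^+ (k - #|A|) * phi A))).
  by apply: ler_sum => s /injectiveP; exact: inner.
set x := \sum_(A | q A) _.
have x0 : 0 <= x by apply: sumr_ge0 => A _; rewrite !mulr_ge0 // exprn_ge0.
rewrite sumr_const -[x *+ _]mulr_natl.
apply: (@le_trans _ _ (n%:R ^+ k * x)).
  rewrite ler_wpM2r // -natrX ler_nat.
  by apply: leq_trans (max_card _) _; rewrite card_ffun card_ord.
rewrite /x mulr_sumr; apply: ler_sum => A _.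
by rewrite exprD mulrCA -mulrA.
Qed.

Lemma clump_le_present S (o : outcome) :
  (clump S o)%:R <=
  \sum_(s : {ffun V -> 'I_n} | injectiveb s && (im s == S)) (present s o)%:R :>
    R.
Proof. by rewrite sum_present ler_peMl // ler1n aut_gt0. Qed.

(** The first disjunct makes the relation reflexive at the empty set. *)
Definition touching (S S' : {set 'I_n}) := (S == S') || (S :&: S' != set0).

Let image_n0 (s : V -> 'I_n) : im s != set0.
Proof.
case/card_gt0P: V_gt0 => v _; apply/set0Pn; exists (s v).
by apply: imset_f; exact: finset.in_setT.
Qed.

Lemma touching_shared s t :
  injective t -> touching (im s) (im t) = (shared s t != set0).
Proof.
move=> ti; rewrite /touching -[shared s t == _]cards_eq0 -shared_image //
  cards_eq0.
by case: eqP => //= ->; rewrite finset.setIid image_n0.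
Qed.

Lemma touching_neq_shared s t : injective s -> injective t ->
  touching (im s) (im t) && (im t != im s) = (shared s t != set0) && (shared s
    t != setT).
Proof.
move=> si ti; rewrite touching_shared //; congr (_ && ~~ _).
rewrite eqEcard !card_imset // leqnn andbT eqEsubset finset.subsetT /=.
apply/fintype.subsetP/fintype.subsetP => [ts v _|ts _ /imsetP[v _ ->]].
  by rewrite inE ts // imset_f // finset.in_setT.
by have := ts v (finset.in_setT _); rewrite inE.
Qed.

(** Up to a constant, the contribution of the pairs of copies sharing i
    vertices; n^(k + (k - i)) counts these pairs. *)
Definition overlap_term (i : nat) : R :=
  n%:R ^+ (k + (k - i)) *
  (p ^+ (2 * #|edges H| - (#|edges H| * i) %/ k) * c%:R ^- (k + (k - i)).-1).

(** The mean of the count, up to a factor between two positive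
    constants when n >= k. *)
Definition mean_scale : R := n%:R ^+ k * (p ^+ #|edges H| * c%:R ^- k.-1).

Let p0 : 0 <= p. Proof. by case/andP: p01 => /ltW. Qed.
Let p1 : p <= 1. Proof. by case/andP: p01 => _ /ltW. Qed.

Lemma fexp_pair_le (s t : {ffun V -> 'I_n}) : injective s -> injective t ->
  shared s t != set0 ->
  E (fun o => (present s o)%:R * (present t o)%:R) <=
  p ^+ (2 * #|edges H| - (#|edges H| * #|shared s t|) %/ k)
    * c%:R ^- (k + (k - #|shared s t|)).-1.
Proof.
move=> si ti st0.
have st1 : im s :&: im t != set0.
  by rewrite -cards_eq0 shared_image // cards_eq0.
rewrite fexp_present2 //.
have -> : #|im s :|: im t| = (k + (k - #|shared s t|))%N.
  rewrite cardsU !card_imset // cardsT shared_image // addnBA //.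
  exact: max_card.
rewrite ler_wpM2r ?invr_ge0 ?exprn_ge0 //.
apply: ler_wiXn2l => //.
rewrite cardsU !card_im_edges // addnn -mul2n leq_sub2l //.
by rewrite leq_divRL // shared_edges.
Qed.

Lemma overlap_sum_le :
  \sum_S \sum_(S' | touching S S' && (S' != S))
     E (fun o => (0 < clump S o)%N%:R * (0 < clump S' o)%N%:R) <=
  \sum_(A : {set V} | (A != set0) && (A != setT)) (k ^ k)%:R * overlap_term
    #|A|.
Proof.
apply: (@le_trans _ _ (\sum_S \sum_(S' | touching S S' && (S' != S))
     \sum_(s : {ffun V -> 'I_n} | injectiveb s && (im s == S))
        \sum_(t : {ffun V -> 'I_n} | injectiveb t && (im t == S'))
   E (fun o => (present s o)%:R * (present t o)%:R))).
  apply: ler_sum => S _; apply: ler_sum => S' _.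
  under [leRHS]eq_bigr do rewrite -fexp_sum.
  rewrite -fexp_sum; apply: fexp_le => [|o]; first exact: weight_ge0.
  under [leRHS]eq_bigr do rewrite -mulr_sumr.
  rewrite -mulr_suml; apply: ler_pM => //.
    by apply: le_trans (clump_le_present S o); rewrite ler_nat;
      case: (clump S o).
  by apply: le_trans (clump_le_present S' o); rewrite ler_nat;
    case: (clump S' o).
rewrite (sum_injections (fun S S' => touching S S' && (S' != S))).
pose phi (A : {set V}) :=
  p ^+ (2 * #|edges H| - (#|edges H| * #|A|) %/ k) * c%:R ^- (k + (k -
    #|A|)).-1.
apply: le_trans (@sum_shared_le (fun A => (A != set0) && (A != setT)) phi _);
  last first.
  by move=> A; rewrite mulr_ge0 ?invr_ge0 ?exprn_ge0.
apply: ler_sum => s /injectiveP si.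
rewrite [leLHS](eq_bigl (fun t : {ffun V -> 'I_n} =>
  injectiveb t && ((shared s t != set0) && (shared s t != setT)))).
  by apply: ler_sum => t /andP[/injectiveP ti /andP[st _]]; exact: fexp_pair_le.
by move=> t; case: injectiveP => //= ti; exact: touching_neq_shared.
Qed.

Lemma touching_sum_le : (0 < n)%N ->
  \sum_S \sum_(S' | touching S S')
     E (fun o => (clump S o)%:R) * E (fun o => (clump S' o)%:R) <=
  \sum_(A : {set V} | A != set0) (k ^ k)%:R * (mean_scale ^+ 2 / n%:R).
Proof.
move=> n0.
pose rho := p ^+ #|edges H| * c%:R ^- k.-1.
have rho0 : 0 <= rho by rewrite mulr_ge0 ?invr_ge0 ?exprn_ge0.
have Eclump S : E (fun o => (clump S o)%:R) <=
    \sum_(s : {ffun V -> 'I_n} | injectiveb s && (im s == S)) rho.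
  apply: (@le_trans _ _ (\sum_(s :
    {ffun V -> 'I_n} | injectiveb s && (im s == S))
      E (fun o => (present s o)%:R))).
    rewrite -fexp_sum; apply: fexp_le => [|o]; first exact: weight_ge0.
    exact: clump_le_present.
  by apply: ler_sum => s /andP[/injectiveP si _]; rewrite fexp_present.
have Eclump0 S : 0 <= E (fun o => (clump S o)%:R).
  by apply: fexp_ge0 => // o; exact: weight_ge0.
apply: (@le_trans _ _ (\sum_S \sum_(S' | touching S S')
     \sum_(s : {ffun V -> 'I_n} | injectiveb s && (im s == S))
        \sum_(t : {ffun V -> 'I_n} | injectiveb t && (im t == S')) rho * rho)).
  apply: ler_sum => S _; apply: ler_sum => S' _.
  under [leRHS]eq_bigr do rewrite -mulr_sumr.
  by rewrite -mulr_suml; apply: ler_pM.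
rewrite (sum_injections touching).
apply: (@le_trans _ _ (\sum_(A : {set V} | A != set0)
    (k ^ k)%:R * (n%:R ^+ (k + (k - #|A|)) * (rho * rho)))).
  apply: le_trans (@sum_shared_le (fun A => A != set0) (fun=> rho * rho) _);
    last first.
    by move=> A; rewrite mulr_ge0.
  apply: ler_sum => s /injectiveP si.
  rewrite [leLHS](eq_bigl (fun t : {ffun V -> 'I_n} =>
    injectiveb t && (shared s t != set0))) //.
  by move=> t; case: injectiveP => //= ti; exact: touching_shared.
apply: ler_sum => A A0; rewrite ler_wpM2l //.
have n0' : 0 < n%:R :> R by rewrite ltr0n.
rewrite ler_pdivlMr // /mean_scale -/rho exprMn -[rho * rho]expr2 mulrAC.
rewrite ler_wpM2r ?exprn_ge0 // -exprSr -exprM -!natrX ler_nat leq_pexp2l //.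
have A1 : (0 < #|A|)%N by rewrite card_gt0.
have := max_card (mem A); lia.
Qed.

Lemma overlap_term_le (i : nat) (B : R) : (0 < i < k)%N ->
  1 <= B -> mean_scale <= B -> overlap_term i ^+ k <= B ^+ (2 * k) / c%:R.
Proof. by move=> ik B1 mB; apply: scale_pow_le; rewrite ?ler1n. Qed.

End Overlap.

(** * Limit rates *)

(** The classes of r partition D, and each meets the transversal in exactly one
    point. *)
Lemma sum_transversal (R : pzSemiRingType) (T : finType) (r : rel T)
    (D : {set T}) (g : T -> R) :
  equivalence_rel r -> (forall x y, x \in D -> r x y -> y \in D) ->
  (forall x y, r x y -> g x = g y) ->
  \sum_(x in D) g x =
  \sum_(x in transversal (equivalence_partition r D) D) #|[set y | r x y]|%:R *
    g x.
Proof.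
move=> eqr Dr gr.
have eqrD : {in D & &, equivalence_rel r} by move=> x y z _ _ _; exact: eqr.
set P := equivalence_partition r D; set X := transversal P D.
have partP : finset.partition P D by exact: equivalence_partitionP.
have trX : is_transversal X P D by exact: transversalP.
have XD := fintype.subsetP (transversal_sub trX).
case/and3P: (partP) => /eqP covP tiP _.
have [x0 x0D|D0] := pickP (mem D); last first.
  rewrite big1 ?big1 // => x; first by move/XD;
    rewrite (D0 x : x \in D = false).
  by rewrite (D0 x : x \in D = false).
pose h x := transversal_repr x0 X (pblock P x).
have PD x : x \in D -> pblock P x \in P by move=> xD;
  rewrite pblock_mem // covP.
have hX x : x \in D -> h x \in X by move=> xD;
  apply: repr_mem_transversal trX _ _ (PD x xD).
rewrite (partition_big h (mem X)) //=; apply: eq_bigr => y yX.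
have yD := XD y yX.
rewrite mulr_natl -sumr_const; apply: eq_big => [x|x /andP[xD /eqP hx]];
  last first.
  apply: gr; rewrite -(pblock_equivalence_partition eqrD) // -hx.
  by apply: repr_mem_pblock trX _ _ (PD x xD).
rewrite inE; apply/andP/idP => [[xD /eqP hx]|ryx].
  have : y \in pblock P x by rewrite -hx; apply:
    repr_mem_pblock trX _ _ (PD x xD).
  by rewrite (pblock_equivalence_partition eqrD) // => rxy;
    have [rxx] := eqr x y x; rewrite rxy => <-.
have xD := Dr _ _ yD ryx; split=> //; apply/eqP; rewrite /h.
have : x \in pblock P y by rewrite (pblock_equivalence_partition eqrD).
by move/(same_pblock tiP) => ->; exact: (pblockK trX x0 yX).
Qed.

Section LimitRates.
Variables (R : realType) (V : finType) (H : sgraph V) (lambda : R).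

(** For j > 0, [clump_density] divided by the probability of a given copy of H;
    unlike the quotient it makes sense at q = 0. *)
Definition density_ratio (j : nat) (q : R) : R :=
  \sum_(F : sgraph V | ncopies H F == j)
     q ^+ (#|edges F| - #|edges H|) * (1 - q) ^+ ('C(#|V|, 2) - #|edges F|).

Lemma limit_rate_sum (q : R) (j : nat) : (0 < j)%N ->
  lambda * (#|Defs.aut H|%:R / (#|V| `!)%:R) * density_ratio j q =
  \sum_(F in supergraphs H | ncopies H F == j) limit_rate H F lambda q.
Proof.
move=> j0.
pose g (F : sgraph V) : R := if ncopies H F == j then
  q ^+ (#|edges F| - #|edges H|) * (1 - q) ^+ ('C(#|V|, 2) - #|edges F|) else 0.
pose D := finset (fun F : sgraph V => (0 < ncopies H F)%N).
have -> : density_ratio j q = \sum_(F in D) g F.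
  rewrite /density_ratio -big_mkcondr /=; apply: eq_bigl => F.
  by rewrite inE; case: eqP => [->|]; rewrite ?andbF // j0.
rewrite (@sum_transversal _ _ (@isomorphic V) D g (@isomorphic_equiv V));
  last 2 first.
- by move=> F F'; rewrite !inE => F0 /(isomorphic_ncopies H) <-.
- move=> F F' FF'; rewrite /g (isomorphic_ncopies H FF') (isomorphic_edges FF')
  //.
rewrite mulr_sumr [RHS]big_mkcondr; apply: eq_bigr => F _; rewrite /g.
case: ifP => _; last by rewrite !mulr0.
have cF := isomorphism_class_card F; have aF := aut_gt0 F.
rewrite /limit_rate -cF natrM.
have c0 : #|[set F' | isomorphic F F']|%:R != 0 :> R.
  rewrite pnatr_eq0 -lt0n; have := fact_gt0 #|V|;
    rewrite -cF muln_gt0 => /andP[]//.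
have a0 : #|Defs.aut F|%:R != 0 :> R by rewrite pnatr_eq0 -lt0n.
move: (_ ^+ _) (_ ^+ _) c0 a0 => x y.
move: (#|_|%:R : R) (#|_|%:R : R) (#|Defs.aut H|%:R : R) => a b c a0 b0.
by field; rewrite a0 b0.
Qed.

(** A graph that contains H and has no further edge is H up to relabelling;
    conversely N(H,H) = 1. *)
Lemma isomorphic_min F : (ncopies H F == 1%N) && (#|edges F| == #|edges H|) =
  isomorphic H F.
Proof.
apply/andP/idP => [[/eqP N1 /eqP FH]|HF].
  have : (0 < ncopies H F)%N by rewrite N1.
  rewrite card_gt0 => /set0Pn[C /copiesP[r ri [_ rF]]].
  apply/set0Pn; exists (perm ri); rewrite isosP.
  have -> : im_edges (perm ri) (edges H) = im_edges r (edges H).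
    by apply: eq_imset => e; apply: eq_imset => v; rewrite permE.
  by rewrite eqEcard rF card_im_edges //= FH leqnn.
rewrite (isomorphic_edges HF) -(isomorphic_ncopies H HF) eqxx; split=> //.
rewrite eqn_leq ncopies_le1 // card_gt0; apply/set0Pn; exists (embedding H id).
have idE : im_edges id (edges H) = edges H.
  by rewrite /im_edges -[RHS]imset_id; apply: eq_imset => e /=;
    rewrite imset_id.
apply/copiesP; exists (finfun id); first by move=> u v; rewrite !ffunE.
have fE : im_edges (finfun id) (edges H) = edges H.
  by rewrite -[RHS]idE; apply: eq_imset => e; apply: eq_imset => v;
    rewrite ffunE.
split; last by rewrite fE.
rewrite /embedding fE idE; congr (_, _).
by apply: eq_imset => v; rewrite ffunE.
Qed.

(** At q = 0 the only graphs with a nonzero term have as many edges as H, and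
    are thus isomorphic to H; there are k! / |Aut H| of them. *)
Lemma limit_rate_sparse j : (0 < j)%N ->
  lambda * (#|Defs.aut H|%:R / (#|V| `!)%:R) * density_ratio j 0 =
  if j == 1%N then lambda else 0.
Proof.
move=> j0.
have termE F : ncopies H F == j ->
   (0 : R) ^+ (#|edges F| - #|edges H|) *
     (1 - 0) ^+ ('C(#|V|, 2) - #|edges F|) =
   ((j == 1%N) && isomorphic H F)%:R.
  move=> /eqP NF; rewrite subr0 expr1n mulr1 expr0n subn_eq0 -isomorphic_min NF.
  have HF : (#|edges H| <= #|edges F|)%N by rewrite ncopies_edges // NF.
  rewrite andbA andbb (eqn_leq #|edges F|) HF andbT; case: leqP => [FH|];
    last by rewrite andbF.
  have : (j <= 1)%N by rewrite -NF ncopies_le1 //; apply/eqP;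
    rewrite eqn_leq HF.
  by case: j j0 {NF} => [|[]].
rewrite /density_ratio (eq_bigr _ termE); case: eqP => [->|_]; last first.
  by rewrite big1 ?mulr0.
rewrite -natr_sum -big_mkcondr.
have -> : (\sum_(F : sgraph V | (ncopies H F == 1%N) && isomorphic H F) 1)%N =
    #|[set F | isomorphic H F]|.
  rewrite -sum1_card; apply: eq_bigl => F; rewrite inE -isomorphic_min.
  by rewrite andbA andbb.
rewrite -(isomorphism_class_card H) natrM.
have a0 : #|Defs.aut H|%:R != 0 :> R by rewrite pnatr_eq0 -lt0n aut_gt0.
have c0 : #|[set F' | isomorphic H F']|%:R != 0 :> R.
  rewrite pnatr_eq0 -lt0n; have := fact_gt0 #|V|.
  by rewrite -(isomorphism_class_card H) muln_gt0 => /andP[].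
move: (#|_|%:R : R) (#|_|%:R : R) a0 c0 => a b a0 b0.
by field; rewrite a0 b0.
Qed.

End LimitRates.

Local Open Scope classical_set_scope.

(** * Convergence to a compound Poisson distribution *)

Lemma expn_le_ffact n k : (k <= n)%N -> (n ^ k <= k ^ k * n ^_ k)%N.
Proof.
move=> kn; rewrite ffact_prod -[X in (n ^ X)%N]card_ord -[X in (_ <= k ^ X *
  _)%N]card_ord.
rewrite -!prod_nat_const -big_split /=; apply: leq_prod => i _.
have := ltn_ord i; nia.
Qed.

Lemma cvg_exprn (R : realType) (f : nat -> R) (l : R) i :
  f n @[n --> \oo] --> l -> f n ^+ i @[n --> \oo] --> l ^+ i.
Proof.
move=> fl; elim: i => [|i IH]; first by under eq_fun do rewrite expr0;
  exact: cvg_cst.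
by under eq_fun do rewrite exprS; rewrite exprS; apply: cvgM.
Qed.

Section CompoundPoissonLimit.
Unset Implicit Arguments.
Variables (R : realType) (V : finType) (H : sgraph V)
  (p : nat -> R) (c : nat -> nat) (lambda : R)
  (d : nat -> measure_display) (Omega : forall n, measurableType (d n))
  (P : forall n, probability (Omega n) R)
  (G : forall n, Omega n -> sgraph 'I_n)
  (X : forall n, Omega n -> {ffun 'I_n -> 'I_(c n)}).
Hypothesis V_gt0 : (0 < #|V|)%N.
Hypothesis H_balanced : balanced H.
Hypothesis p_in01 : forall n, 0 < p n < 1.
Hypothesis c_gt0 : forall n, (0 < c n)%N.
Hypothesis c_infty : c n @[n --> \oo] --> \oo.
Hypothesis GX : forall n, colored_gnp (P n) (p n) (G n) (X n).
Hypothesis mean_cvg :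
  ('E_(P n)[fun w => mono_copies R H (G n w) (X n w)])%E @[n --> \oo] -->
    lambda%:E.

Let wt n := @outcome_weight R n (c n) (p n).
Let total n (o : sgraph 'I_n * {ffun 'I_n -> 'I_(c n)}) := (\sum_S clump H S
  o)%N.
Let T n w := total n (G n w, X n w).
Let mean n := fexp (wt n) (fun o => mono_copies R H o.1 o.2).
Let u n (m : nat) := fexp (wt n) (fun o => (total n o == m)%:R).
Let K := clump_bound V.
Let a n j := j%:R * \sum_S fexp (wt n) (fun o => (clump H S o == j)%:R).

Let wt_ge0 n o : 0 <= wt n o.
Proof. exact: weight_ge0. Qed.

Let total_event n m :
  [set w | T n w = m] = [set w | (fun o => total n o == m) (G n w, X n w)].
Proof. by apply/seteqP; split => w /eqP. Qed.

Let pmf_total n m : pmf (P n) (T n) m = u n m.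
Proof.
rewrite /pmf total_event.
rewrite [X in fine X](outcome_prob (GX n) (fun o =>
  total n o == m)) /= /u /fexp big_mkcond.
by apply: eq_bigr => o _; case: ifP; rewrite ?mulr1 ?mulr0.
Qed.

Let measurable_total n m : measurable [set w | T n w = m].
Proof. by rewrite total_event; exact: (outcome_measurable (GX n) (fun o =>
  total n o == m)). Qed.

Let mean_cvgR : mean n @[n --> \oo] --> lambda.
Proof.
have meanE n : ('E_(P n)[fun w =>
  mono_copies R H (G n w) (X n w)])%E = (mean n)%:E.
  rewrite (outcome_expectation (GX n) (f := fun o =>
    mono_copies R H o.1 o.2)) //.
  by move=> o; rewrite mono_copiesE.
by move: mean_cvg; under eq_fun do rewrite meanE; move/fine_cvg.
Qed.

Let sum_u n M : \sum_(m < M) u n m = fexp (wt n) (fun o =>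
  (total n o < M)%N%:R).
Proof.
rewrite -fexp_sum; apply: fexp_eq => o; case: ltnP => oM.
  rewrite (bigD1 (Ordinal oM)) //= eqxx big1 ?addr0 // => m.
  by rewrite -val_eqE /= eq_sym => /negbTE ->.
by rewrite big1 // => m _; rewrite gtn_eqF // (leq_trans (ltn_ord m)).
Qed.

Let fexp1 n : fexp (wt n) (fun=> 1) = 1.
Proof. by rewrite /fexp; under eq_bigr do rewrite mulr1; exact: weight_sum. Qed.

Let u_ge0 n m : 0 <= u n m.
Proof. by apply: fexp_ge0. Qed.

Let u_sum n M : \sum_(m < M) u n m <= 1.
Proof.
rewrite sum_u -[leRHS](fexp1 n); apply: fexp_le => // o.
by case: (_ < _)%N; rewrite ?ler01.
Qed.

Let u_tail n M : M%:R * (1 - \sum_(m < M) u n m) <= mean n.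
Proof.
rewrite sum_u -[X in X - _](fexp1 n) -fexpB -fexpZ; apply: fexp_le => // o.
rewrite mono_copiesE -/(total n o); case: ltnP => oM; rewrite ?subrr ?mulr0 //.
by rewrite subr0 mulr1 ler_nat.
Qed.

Let mean_bounded : \forall n \near \oo, mean n <= lambda + 1.
Proof.
move/cvgrPdist_le/(_ _ ltr01): mean_cvgR; apply: filterS => n.
by rewrite ler_norml => /andP[? ?]; lra.
Qed.

(** Since n^k is at most k^k n(n-1)...(n-k+1) for n >= k, the scale is at most
    a constant times the mean, which converges. *)
Lemma mean_scale_bounded :
  exists B, 1 <= B /\ \forall n \near \oo, mean_scale H n (c n) (p n) <= B.
Proof.
pose B0 : R := (#|V| ^ #|V|)%:R * #|Defs.aut H|%:R * (lambda + 1).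
exists (1 + `|B0|); split; first by rewrite lerDl.
have le_mean : \forall n \near \oo,
    mean_scale H n (c n) (p n) <= (#|V| ^ #|V|)%:R * #|Defs.aut H|%:R * mean n.
  near=> n.
  have kn : (#|V| <= n)%N by near: n; exact: nbhs_infty_ge.
  rewrite /mean fexp_mono_copies // /mean_scale; set rho := p n ^+ _ * _.
  have a0 : #|Defs.aut H|%:R != 0 :> R by rewrite pnatr_eq0 -lt0n aut_gt0.
  rewrite -[leRHS]mulrA -(mulrA _ _ rho) mulVKf // [leRHS]mulrA.
  case/andP: (p_in01 n) => p0 _.
  rewrite ler_wpM2r ?mulr_ge0 ?invr_ge0 ?exprn_ge0 ?(ltW p0) //.
  by rewrite -natrX -natrM ler_nat expn_le_ffact.
near=> n.
apply: (@le_trans _ _ ((#|V| ^ #|V|)%:R * #|Defs.aut H|%:R * mean n));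
  first by near: n.
apply: (@le_trans _ _ B0); last by rewrite -[leLHS]add0r lerD // ler_norm.
rewrite /B0 ler_wpM2l //; by near: n.
Unshelve. all: by end_near. Qed.

Lemma cvg_inv_nat : n%:R^-1 @[n --> \oo] --> (0 : R).
Proof.
apply/cvgrPdist_le => e e0; near=> n.
have n0 : 0 < n%:R :> R by rewrite ltr0n; near: n; exact: nbhs_infty_gt.
have en : e^-1 <= n%:R by near: n; exact: nbhs_infty_ger.
rewrite sub0r normrN ger0_norm ?invr_ge0 //.
by rewrite -[e]invrK lef_pV2 // posrE ?invr_gt0.
Unshelve. all: by end_near. Qed.

Lemma overlap_term_cvg i : (0 < i < #|V|)%N ->
  overlap_term H n (c n) (p n) i @[n --> \oo] --> (0 : R).
Proof.
move=> iV; have [B [B1 msB]] := mean_scale_bounded.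
have B0 : 0 < B by apply: lt_le_trans B1.
apply/cvgrPdist_le => e e0.
have ek : 0 < e ^+ #|V| by rewrite exprn_gt0.
have c_ge (x : R) : \forall n \near \oo, x <= (c n)%:R.
  have xM : x <= (Num.truncn x).+1%:R by exact/ltW/truncnS_gt.
  have : \forall n \near \oo, ((Num.truncn x).+1 <= c n)%N.
    exact: (c_infty _ (nbhs_infty_ge _)).
  by apply: filterS => n cM; apply: le_trans xM _; rewrite ler_nat.
near=> n.
case/andP: (p_in01 n) => p0 _.
have ot0 : 0 <= overlap_term H n (c n) (p n) i.
  by rewrite /overlap_term !mulr_ge0 ?invr_ge0 ?exprn_ge0 ?(ltW p0).
rewrite sub0r normrN ger0_norm //.
have c0 : 0 < (c n)%:R :> R by rewrite ltr0n.
have cB : B ^+ (2 * #|V|) / e ^+ #|V| <= (c n)%:R by near: n; exact: c_ge.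
rewrite -(ler_pXn2r V_gt0) ?nnegrE ?(ltW e0) //.
apply: le_trans (overlap_term_le (p_in01 n) (c_gt0 n) iV B1 _) _;
  first by near: n.
by rewrite ler_pdivrMr // mulrC -ler_pdivrMr.
Unshelve. all: by end_near. Qed.


Let error n : R :=
  K%:R * \sum_(A : {set V} | (A != finset.set0) && (A != finset.setTfor V))
     (#|V| ^ #|V|)%:R * overlap_term H n (c n) (p n) #|A|
  + \sum_(A : {set V} | A != finset.set0)
     (#|V| ^ #|V|)%:R * (mean_scale H n (c n) (p n) ^+ 2 / n%:R).

Lemma error_cvg : error n @[n --> \oo] --> (0 : R).
Proof.
apply: cvg0D.
  apply: cvg0Z; apply: cvg0_sum => A /andP[A0 AT]; apply: cvg0Z.
  apply: overlap_term_cvg; rewrite card_gt0 A0 /= -cardsT proper_card //.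
  by rewrite finset.properT.
apply: cvg0_sum => A _; apply: cvg0Z.
have [B [B1 msB]] := mean_scale_bounded.
apply: (@squeeze_cvgr _ _ _ _ (fun=> 0) (fun n => B ^+ 2 * n%:R^-1));
  last 2 first.
- exact: cvg_cst.
- by apply: cvg0Z; exact: cvg_inv_nat.
near=> n.
case/andP: (p_in01 n) => p0 _.
have ms0 : 0 <= mean_scale H n (c n) (p n).
  by rewrite /mean_scale !mulr_ge0 ?invr_ge0 ?exprn_ge0 ?(ltW p0).
rewrite mulr_ge0 ?invr_ge0 ?exprn_ge0 //= ler_wpM2r ?invr_ge0 //.
have msn : mean_scale H n (c n) (p n) <= B by near: n.
by apply: lerXn2r => //; rewrite nnegrE (le_trans ler01).
Unshelve. all: by end_near. Qed.

Lemma clump_far_indep n S (f g : nat -> R) :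
  fexp (wt n) (fun o => f (clump H S o) *
                        g (\sum_(S' | ~~ touching S S') clump H S' o)%N) =
  fexp (wt n) (fun o => f (clump H S o)) *
  fexp (wt n) (fun o => g (\sum_(S' | ~~ touching S S') clump H S' o)%N).
Proof.
apply: (@fexp_indep R n (c n) (p n) (c_gt0 n) S (fun o => f (clump H S o))
  (fun o => g (\sum_(S' | ~~ touching S S') clump H S' o)%N)) => o o' oo'.
  by rewrite (clump_agree_in H oo').
congr g; apply: eq_bigr => S'; rewrite negb_or negbK => /andP[_ SS'].
by apply: clump_agree_in; apply: agree_out_in oo'; rewrite -finset.setI_eq0.
Qed.

(** The clumps satisfy the recursion up to [error]: clumps on disjoint sets
    are independent, and the pairs of distinct touching sets are those whose
    embeddings share some but not all vertices. *)
Lemma recursion_cvg m :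
  m%:R * u n m - \sum_(j < K.+1 | (j <= m)%N) a n j * u n (m - j)
    @[n --> \oo] --> (0 : R).
Proof.
apply/norm_cvg0P.
apply: (@squeeze_cvgr _ _ _ _ (fun=> 0) error); last 2 first.
- exact: cvg_cst.
- exact: error_cvg.
near=> n; rewrite normr_ge0 /=.
have n0 : (0 < n)%N by near: n; exact: nbhs_infty_gt.
have sumE : \sum_(j < K.+1 | (j <= m)%N) a n j * u n (m - j) =
    \sum_(j < K.+1) a n j * fexp (wt n) (fun o => (j + total n o == m)%N%:R).
  rewrite big_mkcond; apply: eq_bigr => j _; case: leqP => jm.
    congr (_ * _); apply: fexp_eq => o; congr (nat_of_bool _)%:R.
    by apply/eqP/eqP => [->|<-]; rewrite ?subnKC ?addKn.
  rewrite [X in _ = _ * X](_ : _ = 0) ?mulr0 // /fexp big1 // => o _.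
  by rewrite gtn_eqF ?mulr0 // (leq_trans jm) // leq_addr.
rewrite sumE.
have touching_refl : reflexive (@touching n) by move=> S;
  rewrite /touching eqxx.
apply: le_trans (approx_recursion (wt_ge0 n) touching_refl (@clump_le V H n (c
  n))
  (@clump_far_indep n) m) _.
rewrite lerD //.
  by rewrite ler_wpM2l //; exact: overlap_sum_le.
exact: touching_sum_le.
Unshelve. all: by end_near. Qed.

Variable q : R.
Hypothesis p_cvg : p n @[n --> \oo] --> q.

Let b j := j%:R *
  (lambda * (#|Defs.aut H|%:R / (#|V| `!)%:R) * density_ratio H j q).

Lemma density_ratio_cvg j :
  density_ratio H j (p n) @[n --> \oo] --> density_ratio H j q.
Proof.
apply: cvg_big => [|F _]; first exact: add_continuous.
by apply: cvgM; apply: cvg_exprn => //; apply: cvgB => //; exact: cvg_cst.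
Qed.

Lemma coefficient_cvg j : a n j @[n --> \oo] --> b j.
Proof.
have [->|j0] := posnP j.
  rewrite /a /b mul0r; under eq_fun do rewrite mul0r; exact: cvg_cst.
rewrite /a /b; under eq_fun do rewrite clump_coeff //.
apply: cvgM; first exact: cvg_cst.
apply: cvgM; last exact: density_ratio_cvg.
by apply: cvgM; [exact: mean_cvgR|exact: cvg_cst].
Qed.

(** The common form of the two regimes: only the limit q of p and the recursion
    of the limit law matter. *)
Lemma cvg_compound d' (Omega' : measurableType d') (Q : probability Omega' R)
    (W : Omega' -> nat) :
  (forall m, measurable [set w | W w = m]) ->
  (forall m, m%:R * pmf Q W m =
     \sum_(j < K.+1 | (j <= m)%N) b j * pmf Q W (m - j)) ->
  cvg_in_distribution P (fun n w => mono_copies R H (G n w) (X n w))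
     Q (fun w => (W w)%:R).
Proof.
move=> mW recW.
apply: (pmf_cvg_in_distribution (T := T)) => //.
  by move=> n w; exact: (mono_copiesE R H (G n w, X n w)).
move=> m; under eq_fun do rewrite pmf_total.
apply: (@pmf_cvg R K u (pmf Q W) a b mean lambda) => //.
- by move=> k; exact: pmf_ge0.
- exact: pmf_sum_cvg.
- by move=> n; rewrite /a mul0r.
- by move=> j _; exact: coefficient_cvg.
- exact: recursion_cvg.
Qed.

End CompoundPoissonLimit.

(** * The sparse and the dense regime *)

Lemma poisson_recursion (R : realType) (lambda : R) m : 0 < lambda ->
  m%:R * pmf (pois lambda) (fun k => k) m =
  if m is m'.+1 then lambda * pmf (pois lambda) (fun k => k) m' else 0.
Proof.
move=> l0.
have pmfE k : pmf (pois lambda) (fun k => k) k = poisson_pmf lambda k.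
  rewrite /pmf (_ : [set w | w = k] = [set k]) //.
  by rewrite pois_set1.
case: m => [|m]; first by rewrite mul0r.
by rewrite !pmfE poisson_pmf_succ.
Qed.

Lemma clump_bound_gt0 (V : finType) : (0 < clump_bound V)%N.
Proof. by apply/card_gt0P; exists (finset.set0, finset.set0). Qed.

Lemma supergraph_ncopies (V : finType) (H F : sgraph V) :
  F \in supergraphs H -> (0 < ncopies H F)%N.
Proof.
have eqr : {in finset (fun F : sgraph V => (0 < ncopies H F)%N) & &,
    equivalence_rel (@isomorphic V)}.
  by move=> x y z _ _ _; exact: isomorphic_equiv.
move/(fintype.subsetP (transversal_sub (transversalP (equivalence_partitionP
  eqr)))).
by rewrite inE.
Qed.

Theorem theorem1p3 (R : realType) (V : finType) (H : sgraph V)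
    (p : nat -> R) (c : nat -> nat) (lambda : R)
    (d : nat -> measure_display) (Omega : forall n, measurableType (d n))
    (P : forall n, probability (Omega n) R)
    (G : forall n, Omega n -> sgraph 'I_n)
    (X : forall n, Omega n -> {ffun 'I_n -> 'I_(c n)})
    (V_ge2 : (2 <= #|V|)%N)
    (H_connected : connected_graph H)
    (H_balanced : balanced H)
    (p_in01 : forall n, 0 < p n < 1)
    (c_gt0 : forall n, (0 < c n)%N)
    (c_infty : c n @[n --> \oo] --> \oo)
    (GX : forall n, colored_gnp (P n) (p n) (G n) (X n))
    (lambda_gt0 : 0 < lambda)
    (mean_cvg : ('E_(P n)[fun w => mono_copies R H (G n w) (X n w)])%E
                  @[n --> \oo] --> lambda%:E) :
  (much_less (fun n => n%:R `^ (- (#|V|%:R / #|edges H|%:R))) p ->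
   much_less p (fun=> 1) ->
   cvg_in_distribution P (fun n w => mono_copies R H (G n w) (X n w))
     (pois lambda) (fun k => k%:R))
  /\
  (forall q : R, (forall n, p n = q) ->
   forall (d' : measure_display) (Omega' : measurableType d')
     (Q : probability Omega' R) (Z : sgraph V -> {RV Q >-> nat}),
   (forall F, F \in supergraphs H ->
      distribution Q (Z F) =1 pois (limit_rate H F lambda q)) ->
   mutually_independent (supergraphs H) Z ->
   cvg_in_distribution P (fun n w => mono_copies R H (G n w) (X n w))
     Q (fun w => (\sum_(F in supergraphs H) ncopies H F * Z F w)%N%:R)).
Proof.
have V_gt0 : (0 < #|V|)%N by apply: leq_trans V_ge2.
split.
- move=> _ p0.
  have p_cvg : p n @[n --> \oo] --> (0 : R).
    by move: p0; rewrite /much_less; under eq_fun do rewrite divr1.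
  apply: (cvg_compound _ _ _ _ _ _ _ _ _ _ _ V_gt0 H_balanced p_in01 c_gt0
    c_infty GX mean_cvg _ p_cvg _ _ _ (fun k => k)) => // m.
  rewrite poisson_recursion //.
  have bE (j : nat) : j%:R * (lambda * (#|Defs.aut H|%:R / #|V| `!%:R)
       * density_ratio H j 0) = if j == 1%N then lambda else 0.
    case: j => [|j]; first by rewrite mul0r.
    rewrite limit_rate_sparse //; case: eqP => [->|]; last by rewrite mulr0.
    by rewrite mul1r.
  under eq_bigr => j _ do rewrite bE.
  have K1 : (1 < (clump_bound V).+1)%N by rewrite ltnS clump_bound_gt0.
  rewrite big_mkcond (bigD1 (Ordinal K1)) //= big1 ?addr0; last first.
    by move=> j; rewrite -val_eqE /= => /negbTE ->; rewrite mul0r; case: ifP.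
  by case: m => // m; rewrite subSS subn0.
- move=> q pq d' Omega' Q Z Z_pois Z_indep.
  have q01 : 0 < q < 1 by rewrite -(pq 0%N).
  have p_cvg : p n @[n --> \oo] --> q by under eq_fun do rewrite pq;
    exact: cvg_cst.
  have N_gt0 F : F \in supergraphs H -> (0 < ncopies H F)%N by exact:
    supergraph_ncopies.
  have r_gt0 F : F \in supergraphs H -> 0 < limit_rate H F lambda q.
    case/andP: q01 => q0 q1 _.
    rewrite /limit_rate !mulr_gt0 ?exprn_gt0 ?subr_gt0 ?invr_gt0 // ltr0n
      aut_gt0 //.
  apply: (cvg_compound _ _ _ _ _ _ _ _ _ _ _ V_gt0 H_balanced p_in01 c_gt0
    c_infty GX mean_cvg _ p_cvg _ _ _ (fun w =>
      (\sum_(F in supergraphs H) ncopies H F * Z F w)%N)) => m.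
    exact: (measurable_compound Z N_gt0).
  apply: etrans (compound_recursion N_gt0 r_gt0 Z_pois Z_indep m) _.
  set f := pmf _ _.
  rewrite (partition_big (fun F => inord (ncopies H F) : 'I_(clump_bound V).+1)
     (fun j => (j <= m)%N)) /=; last first.
    by move=> F /andP[_ Fm]; rewrite inordK // ltnS max_card.
  apply: eq_bigr => j jm; have [j0|j0] := posnP j.
    rewrite j0 !mul0r big1 // => F /andP[/andP[/N_gt0 NF _] /eqP Nj].
    by move: j0; rewrite -Nj inordK ?ltnS ?max_card // => N0; rewrite N0 in NF.
  rewrite limit_rate_sum // mulr_sumr mulr_suml.
  apply: eq_big => [F|F /andP[_ /eqP Fj]].
    rewrite -andbA; congr (_ && _).
    rewrite -val_eqE /= inordK ?ltnS ?max_card //.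
    by case: eqP => [->|]; rewrite ?jm ?andbF.
  by rewrite -Fj inordK // ltnS max_card.
Qed.
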